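(* Let $n\ge3$ and $0<\mu<\overline{v}$, and consider the setting with $n$ bidders. Let $\underline{v}$ be the smaller of the two (positive) solutions of $$\left(n-\frac{1}{n-1}+\log\frac{\overline{v}}{\underline{v}}\right)\underline{v}=(n-1)^2\mu .$$ Then there is an equilibrium $(Q^*,F^* )\in\mathcal{Q}\times\mathcal{F}$ of the reduced zero-sum game, i.e. $$\mathrm{Rev}_{F^*}(Q)\le \mathrm{Rev}_{F^*}(Q^* )\le \mathrm{Rev}_{F}(Q^* )\quad\text{for all } Q\in\mathcal{Q},\ F\in\mathcal{F}$$ (so that $Q^*\in\operatorname{argmax}_{Q\in\mathcal{Q}}\min_{F\in\mathcal{F}}\mathrm{Rev}_F(Q)$ and $F^*\in\operatorname{argmin}_{F\in\mathcal{F}}\max_{Q\in\mathcal{Q}}\mathrm{Rev}_F(Q)$), described as follows. (1) If $\underline{v}\le\overline{v}$, then, with $v_0=\frac{\underline{v}}{n-1}$, $$F^*(v)=\begin{cases}0 & v\in[0,v_0),\\ 1-\frac{1}{(n-1)^2} & v\in[v_0,\underline{v}),\\ 1-\frac{v_0}{v(n-1)} & v\in[\underline{v},\overline{v}),\\ 1 & v\ge\overline{v},\end{cases}$$ $$Q^*(r)=\begin{cases}\left(1-\frac{v_0}{\overline{v}(n-1)}\right)^{n-1}\left(\frac{(n-1)^2}{(n-1)^2-1}\right)^{n-1}\left(\frac{n-1-\frac{1}{n-1}}{n-1-\frac{1}{n-1}+\log(\overline{v}/\underline{v})}\right) & r\in[0,\underline{v}),\\[6pt] \left(1-\frac{v_0}{\overline{v}(n-1)}\right)^{n-1}\left(\frac{(n-1)r}{(n-1)r-v_0}\right)^{n-1}\left(\frac{n-1-\frac{1}{n-1}+\log(r/\underline{v})}{n-1-\frac{1}{n-1}+\log(\overline{v}/\underline{v})}\right)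 & r\in[\underline{v},\overline{v}].\end{cases}$$ (2) If $\underline{v}\ge\overline{v}$, then, with $v_0=\mu-\frac{\overline{v}-\mu}{(n-1)^2-1}$, $$F^*(v)=\begin{cases}0 & v\in[0,v_0),\\ 1-\frac{1}{(n-1)^2} & v\in[v_0,\overline{v}),\\ 1 & v\ge\overline{v},\end{cases}\qquad Q^*(r)=1\quad (r\ge0).$$
   Context: A seller offers one item to $n$ bidders whose values $v_1,\dots,v_n$ are i.i.d. from a distribution $F$. Distributions are identified with their CDFs (so they are $0$ on $(-\infty,0)$ and $1$ on $[\overline{v},\infty)$ for distributions supported in $[0,\overline{v}]$); $\log$ is the natural logarithm. $\mathcal{F}=\mathcal{F}(\mu,\overline{v})$ is the set of all probability distributions with expectation $\mu$ and support contained in $[0,\overline{v}]$. $\mathcal{Q}$ is the set of all probability distributions (of reserve prices) with support contained in $[0,\overline{v}]$. In the second-price auction with reserve $r$, bidders bid their values; the item is sold to a highest bidder if and only if the highest value is strictly greater than $r$, and the winner then pays the maximum of $r$ and the second-highest value. Thus, with $v^{(1)}\ge v^{(2)}$ the two highest of the values $v_1,\dots,v_n$ drawn i.i.d. from $F$, $$\mathrm{Rev}_F(r)=\mathbb{E}\left[\max\{r,v^{(2)}\}\cdot \mathbf{1}_{v^{(1)}>r}\right],\qquad \mathrm{Rev}_F(Q)=\mathbb{E}_{r\sim Q}\left[\mathrm{Rev}_F(r)\right].$$ In the reduced zero-sum game the seller chooses $Q\in\mathcal{Q}$, the adversary chooses $F\in\mathcal{F}$, and the payoff $\mathrm{Rev}_F(Q)$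 is maximized by the seller and minimized by the adversary. *)

(* Defs.v *)
From HB Require Import structures.
From mathcomp Require Import all_boot all_order all_algebra.
From mathcomp Require Import all_classical all_reals all_analysis.

Set Implicit Arguments.
Unset Strict Implicit.
Unset Printing Implicit Defensive.

Import Order.TTheory GRing.Theory Num.Theory.
Import numFieldNormedType.Exports.

Local Open Scope classical_set_scope.
Local Open Scope ring_scope.

(* A distribution on the reals is a Borel probability measure. *)
Notation law R := (probability (measurableTypeR R) R).

Section IID.
Context {d : measure_display} {T : measurableType d} {R : realType}.

Definition tcons n (x : T * n.-tuple T) : n.+1.-tuple T := [tuple of x.1 :: x.2].

Lemma measurable_tcons n : measurable_fun setT (@tcons n).
Proof. exact: measurable_cons. Qed.

HB.instance Definition _ n := isMeasurableFun.Build _ _ _ _ (@tcons n)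
  (@measurable_tcons n).

(* The n-fold product measure F x ... x F on n-tuples. *)
Fixpoint iid (F : probability T R) n : probability (n.-tuple T) R :=
  match n with
  | 0 => dirac [tuple]
  | m.+1 => distribution (F \x iid F m)%E (@tcons m)
  end.

Local Open Scope ereal_scope.

Lemma iid_box (F : probability T R) n (A : 'I_n -> set T) :
  (forall i, measurable (A i)) ->
  iid F n [set v | forall i, A i (tnth v i)] = \prod_(i < n) F (A i).
Proof.
elim: n A => [|n IH] A mA /=.
  by rewrite big_ord0 diracE mem_set// => -[].
rewrite /distribution /pushforward big_ord_recl -IH; last by move=> i; exact: mA.
rewrite -product_measure1E//; last first.
  rewrite (_ : [set v | _] = \big[setI/setT]_(i < n)
      ((@tnth n T ^~ i) @^-1` A (lift ord0 i))).
    apply: bigsetI_measurable => i _.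
    by rewrite -[X in measurable X]setTI; apply: measurable_tnth.
  rewrite -bigcap_seq; apply/seteqP; split => [v Av i _|v Av i] /=.
    exact: Av.
  by apply: (Av i) => /=; rewrite mem_index_enum.
congr (_ _); apply/seteqP; split => -[x v] /=.
  move=> Av; split => /= [|i]; first by have := Av ord0; rewrite tnth0.
  by have := Av (lift ord0 i); rewrite tnthS.
move=> [Ax Av] i; have [->|i0] := eqVneq i ord0; first by rewrite tnth0.
have [j ->] : exists j, i = lift ord0 j.
  by case: (unliftP ord0 i) i0 => [j ->|->]; [exists j|rewrite eqxx].
by rewrite tnthS; exact: Av.
Qed.

End IID.

Section ReservePriceGame.
Context {R : realType}.
Implicit Types (F Q : law R) (r v mu vbar vl x : R) (n : nat).

Definition idTR : measurableTypeR R -> R := idfun.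

HB.instance Definition _ := @isMeasurableFun.Build _ _ _ _ idTR
  (@measurable_id _ _ setT).

Definition cdf_law F v : \bar R := cdf (idTR : {RV F >-> R}) v.

(* As [0, vbar] is closed, it contains the support iff it has full mass. *)
Definition supported vbar F : Prop := F `[0, vbar]%classic = 1%E.

Definition calF mu vbar : set (law R) :=
  [set F | supported vbar F /\ 'E_F[idTR]%E = mu%:E].

Definition calQ vbar : set (law R) := [set Q | supported vbar Q].

(* order_stat v k is the (k+1)-th largest entry of v, counted with
   multiplicity. *)
Definition order_stat n (v : n.-tuple R) (k : nat) : R :=
  nth 0 (sort (fun a b => b <= a) v) k.

Definition revenue n r (v : n.-tuple R) : R :=
  if r < order_stat v 0 then Num.max r (order_stat v 1) else 0.

Definition Rev n F r : \bar R := 'E_(iid F n)[revenue r]%E.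

Definition RevQ n F Q : \bar R := (\int[Q]_r Rev n F r)%E.

Definition equilibrium n mu vbar Q F : Prop :=
  [/\ calQ vbar Q, calF mu vbar F,
      forall Q', calQ vbar Q' -> (RevQ n F Q' <= RevQ n F Q)%E
    & forall F', calF mu vbar F' -> (RevQ n F Q <= RevQ n F' Q)%E].

Definition worst_revenue n mu vbar Q : \bar R :=
  ereal_inf [set RevQ n F Q | F in calF mu vbar].

Definition best_revenue n vbar F : \bar R :=
  ereal_sup [set RevQ n F Q | Q in calQ vbar].

Definition maximin n mu vbar Q : Prop :=
  calQ vbar Q /\
  forall Q', calQ vbar Q' ->
    (worst_revenue n mu vbar Q' <= worst_revenue n mu vbar Q)%E.

Definition minimax n mu vbar F : Prop :=
  calF mu vbar F /\
  forall F', calF mu vbar F' ->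
    (best_revenue n vbar F <= best_revenue n vbar F')%E.

Definition vlow_eq n mu vbar x : Prop :=
  (n%:R - (n%:R - 1)^-1 + ln (vbar / x)) * x = (n%:R - 1) ^+ 2 * mu.

(* CDFs on the whole line of the equilibrium pair, "low" for vl <= vbar and
   "high" for vbar <= vl.  The thresholds v0 are positive in their respective
   cases, so the first branch of the CDFs Fstar covers the negative reals. *)
Definition v0_low n vl : R := vl / (n%:R - 1).

Definition Fstar_low n vbar vl v : R :=
  let v0 := v0_low n vl in
  if v < v0 then 0
  else if v < vl then 1 - ((n%:R - 1) ^+ 2)^-1
  else if v < vbar then 1 - v0 / (v * (n%:R - 1))
  else 1.

Definition Qstar_low n vbar vl r : R :=
  let v0 := v0_low n vl in
  let k := n%:R - 1 - (n%:R - 1)^-1 in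
  let c := (1 - v0 / (vbar * (n%:R - 1))) ^+ (n - 1) in
  if r < 0 then 0
  else if r < vl then
    c * ((n%:R - 1) ^+ 2 / ((n%:R - 1) ^+ 2 - 1)) ^+ (n - 1)
      * (k / (k + ln (vbar / vl)))
  else if r <= vbar then
    c * ((n%:R - 1) * r / ((n%:R - 1) * r - v0)) ^+ (n - 1)
      * ((k + ln (r / vl)) / (k + ln (vbar / vl)))
  else 1.

Definition v0_high n mu vbar : R :=
  mu - (vbar - mu) / ((n%:R - 1) ^+ 2 - 1).

Definition Fstar_high n mu vbar v : R :=
  if v < v0_high n mu vbar then 0
  else if v < vbar then 1 - ((n%:R - 1) ^+ 2)^-1
  else 1.

Definition Qstar_high r : R := if r < 0 then 0 else 1.

End ReservePriceGame.

(* Main.v *)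
(* Write m = n - 1, G(f) = 1 - n f^(n-1) + (n-1) f^n for the probability that at
   least two values exceed a level x with F(x) = f, and Q for the cdf of the
   reserve.  Since the revenue is r 1[v1 > r] + int_r^oo 1[v2 > x] dx, Tonelli
   gives Rev_F(r) = r (1 - F(r)^n) + int_r^oo G(F(x)) dx, and, for a reserve
   without atoms outside 0,
     Rev_F(Q) = int_0^vbar (s(x) (1 - F(x)^n) + Q(x) G(F(x))) dx
   with s(x) = x Q'(x).  No density of Q is needed: s enters only through
   t Q(t) = int_0^t (Q + s).
   Adversary: Rev_F(Q) is minimised over laws F of given mean by minimising a
   Lagrangian pointwise in the value f = F(x); both steps of that minimisation
   are instances of AM-GM.
   Seller: against F*, r |-> Rev(r) is constant on [0, v0[, increasing on
   [v0, w[ and constant on [w, vbar[, where w = min(vl, vbar); the level on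
   [0, v0[ is at least the one on [w, vbar[, with equality if v0 = w / m.
   Both cases of the theorem are the single construction with parameters
   (w, v0), w / m <= v0 < w. *)

(* In the code n is [m.+2], and [M] is [m.+1], that is n - 1. Indifference forces the formulas. The
   seller is indifferent on [w, vbar[ iff r (1 - F^n) has derivative G(F), that is r F' = 1 - F, so
   F = 1 - c/r. The first-order condition of the Lagrangian at f = F(x) is x Q' f^(n-1) + (n-1) Q
   f^(n-2) (1 - f) = lam / n. Since x F' = 1 - F, its left-hand side is x times the derivative of Q
   F^(n-1), so Q F^(n-1) is lam / n times log x plus a constant: this is [qbody]. Below w the
   reserve has mass only at 0, so s = 0, Q is constant, and one function q G(f) + lam f serves all
   these levels. There F takes the values 0 and [hold], so both must minimise it; stationarity at
   [hold] and equal values at 0 and [hold] give (n-1)^2 hold = n (n-2), hence hold = 1 - 1/(n-1)^2.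
   Continuity of F at w then gives c, and s(w) = 0 gives the constant [qmin]. With two separate
   minimisers the Lagrangian is not convex in f, so first-order conditions do not prove minimality;
   the AM-GM decomposition does. *)
From HB Require Import structures.
Require Import Defs.
From mathcomp Require Import all_boot all_order all_algebra.
From mathcomp Require Import all_classical all_reals all_analysis.
From mathcomp Require Import measurable_realfun.
From mathcomp Require Import ring lra.

Set Implicit Arguments.
Unset Strict Implicit.
Unset Printing Implicit Defensive.

Import Order.TTheory GRing.Theory Num.Theory.
Import numFieldNormedType.Exports.

Local Open Scope classical_set_scope.
Local Open Scope ring_scope.

(** * Pointwise minimisation of the Lagrangian *)

Section Algebra.
Context {R : realFieldType}.
Implicit Types (a f g y K s q lam : R).

(** AM-GM for one copy of a^(m+1) and m copies of f^(m+1). Passing from m to m + 1 multiplies the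
    gap by a and adds a nonnegative multiple of (f - a)^2, so no roots are needed. *)
Lemma ler_AGM_expr m a f : 0 <= a -> 0 <= f ->
  m.+1%:R * a * f ^+ m <= a ^+ m.+1 + m%:R * f ^+ m.+1.
Proof.
move=> a0 f0; elim: m => [|m IH]; first by rewrite !expr1 expr0; lra.
rewrite -subr_ge0; rewrite -subr_ge0 in IH.
have -> : a ^+ m.+2 + m.+1%:R * f ^+ m.+2 - m.+2%:R * a * f ^+ m.+1 =
    a * (a ^+ m.+1 + m%:R * f ^+ m.+1 - m.+1%:R * a * f ^+ m)
    + m.+1%:R * f ^+ m * (f - a) ^+ 2.
  by rewrite -(natr1 m.+1) -(natr1 m) !exprS; ring.
by rewrite addr_ge0// mulr_ge0 ?sqr_ge0// mulr_ge0 ?exprn_ge0.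
Qed.

(* Probability that at least two of [n] independent draws exceed a level that
   each draw stays below with probability [f]. *)
Definition second_tail n f : R := 1 - n%:R * f ^+ n.-1 + n.-1%:R * f ^+ n.

Lemma second_tail_ge0 n f : 0 <= f <= 1 -> 0 <= second_tail n f.
Proof.
move=> /andP[f0 f1]; case: n => [|m]; rewrite /second_tail/=.
  by rewrite !mulr0n !mul0r subr0 addr0 ler01.
by have := ler_AGM_expr m ler01 f0; rewrite expr1n mulr1; lra.
Qed.

(** [g] stands for the value of a candidate cdf at one level, [s] and [q] for the seller's data
    there. As the mean is the integral of 1 - F, the term [lam * g] prices the constraint on the
    mean. *)
Definition lagrangian n s q lam g : R :=
  s * (1 - g ^+ n) + q * second_tail n g + lam * g.

(* The difference of the two sides is affine and nondecreasing in [y] by AM-GM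
   with [m + 2] terms; at [y = (m + 1) a] it is AM-GM with [m + 1] terms. *)
Lemma lagrangian_min m K a y f : 0 <= K -> 0 < a -> 0 <= f ->
  m.+1%:R * a <= y ->
  let L := lagrangian m.+2 (K * (1 - m.+1%:R * ((1 - a) / a) * y)) (K * y)
             (m.+2%:R * (K * a ^+ m.+1)) in
  L a <= L f :> R.
Proof.
move=> K0 a0 f0 ya /=; rewrite -subr_ge0.
have an0 : a != 0 by rewrite gt_eqF.
set d := (X in 0 <= X).
have -> : d = K * ((y - m.+1%:R * a) / a
      * (a ^+ m.+2 + m.+1%:R * f ^+ m.+2 - m.+2%:R * a * f ^+ m.+1)
    + m.+2%:R * f * (a ^+ m.+1 + m%:R * f ^+ m.+1 - m.+1%:R * a * f ^+ m)).
  rewrite /d /lagrangian /second_tail /= -(natr1 m.+1) -(natr1 m) !exprS.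
  by field.
apply: mulr_ge0 => //; apply: addr_ge0; apply: mulr_ge0.
- by apply: divr_ge0; [rewrite subr_ge0|exact: ltW].
- by rewrite subr_ge0; apply: ler_AGM_expr; rewrite // ltW.
- by rewrite mulr_ge0.
- by rewrite subr_ge0; apply: ler_AGM_expr; rewrite // ltW.
Qed.

End Algebra.

(** * Order statistics of a tuple through counting *)

Section OrderStatistics.
Context {R : realType}.
Implicit Types (x r : R) (n k : nat).

(** Counting the entries above [x] is invariant under permutation, so this removes the sort from all
    that follows. *)
Lemma sorted_nth_leE (s : seq R) k x : sorted (fun a b : R => b <= a) s ->
  (k < size s)%N -> (nth 0 s k <= x) = (count (fun y : R => x < y)%R s <= k)%N.
Proof.
elim: s k => [//|y s IH] k /= ps; rewrite ltnS => ks.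
have yall : all (fun z : R => z <= y) s.
  by apply: order_path_min ps => a b c ab bc; exact: le_trans bc ab.
have [xy|yx] := ltP x y.
  case: k ks => [|k] ks; first by rewrite /= leNgt xy.
  by rewrite /= add1n ltnS IH// (path_sorted ps).
have -> : count (fun z : R => x < z)%R s = 0%N.
  apply/eqP; rewrite -leqn0 leqNgt -has_count; apply/hasPn => z zs.
  by rewrite -leNgt (le_trans _ yx)//; exact: (allP yall).
rewrite addn0; case: k ks => [|k] ks /=; first by rewrite yx.
by rewrite (le_trans _ yx)//; apply: (allP yall); rewrite mem_nth.
Qed.

Lemma order_stat_leE n (v : n.-tuple R) k x : (k < n)%N ->
  (order_stat v k <= x) = (count (fun y : R => x < y)%R v <= k)%N.
Proof.
move=> kn; rewrite /order_stat sorted_nth_leE ?size_sort ?size_tuple//.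
  by rewrite count_sort.
by apply: sort_sorted => a b; exact: le_total.
Qed.

Lemma count_tuple n (v : n.-tuple R) (p : pred R) :
  count p v = (\sum_(i < n) p (tnth v i))%N.
Proof. by rewrite -sum1_count big_tuple big_mkcond; apply: eq_bigr => i _; case: p. Qed.

Lemma order_stat0_le n (v : n.-tuple R) x : (0 < n)%N ->
  (order_stat v 0 <= x) = [forall i, tnth v i <= x].
Proof.
move=> n0; rewrite order_stat_leE// leqn0 count_tuple sum_nat_eq0.
by apply: eq_forallb => i; rewrite leNgt; case: ltP.
Qed.

(** The two alternatives, no entry above [x] or exactly one, are disjoint unions of boxes, whose
    probabilities [iid_box] gives. *)
Lemma order_stat1_le n (v : n.-tuple R) x : (1 < n)%N ->
  (order_stat v 1 <= x) =
  [forall i, tnth v i <= x] || 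
  [exists i, (x < tnth v i) && [forall j, (j != i) ==> (tnth v j <= x)]].
Proof.
move=> n1; rewrite order_stat_leE// count_tuple.
have [/forallP h|/forallPn[i]] := boolP [forall i, tnth v i <= x].
  by rewrite /= big1// => i _; rewrite ltNge h.
rewrite -ltNge => xi /=; rewrite (bigD1 i)//= xi add1n ltnS leqn0 sum_nat_eq0.
apply/forallP/existsP => [h|[j /andP[xj /forallP h]] l].
  exists i; rewrite xi; apply/forallP => j; apply/implyP => ji.
  by have := h j; rewrite ji /= eqb0 -leNgt.
have ij : i = j by apply/eqP; apply: contraTT xi => ij; rewrite -leNgt (implyP (h i)).
by rewrite ij; apply/implyP => lj; rewrite eqb0 -leNgt (implyP (h l)).
Qed.

Lemma order_stat_ge n (v : n.-tuple R) : (1 < n)%N ->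
  order_stat v 1 <= order_stat v 0.
Proof.
move=> n1; rewrite order_stat_leE// (leq_trans _ (leqnSn 0))//.
by rewrite -order_stat_leE// ltnW.
Qed.

Lemma measurable_order_stat n k :
  measurable_fun setT (fun v : n.-tuple R => order_stat v k).
Proof.
(* Beyond the length of the tuple [nth] returns its default 0, a constant function of [v]. *)
have [nk|kn] := leqP n k.
  rewrite [X in measurable_fun _ X](_ : _ = cst 0); first exact: measurable_cst.
  by apply/funext => v; rewrite /order_stat nth_default// size_sort size_tuple.
apply: (measurability _ (RGenOInfty.measurableE R)) => //.
move=> _ [_ [x ->] <-].
have mc : measurable_fun setT (fun v : n.-tuple R => (\sum_(i < n) (x < tnth v i)%R)%N).
  elim: (index_enum _) => [|i s IH].
    by under eq_fun do rewrite big_nil; exact: measurable_cst.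
  under eq_fun do rewrite big_cons.
  apply: measurable_fun_addn => //; rewrite /nat_of_bool.
  apply: measurable_fun_ifT => //; apply: measurable_fun_ltr => //.
  exact: measurable_tnth.
have /(_ measurableT [set true]) := measurable_fun_ltn (measurable_cst k) mc.
rewrite !setTI => /(_ I); congr measurable; apply/seteqP; split => v /=;
  by rewrite in_itv/= andbT ltNge order_stat_leE// count_tuple ltnNge.
Qed.

End OrderStatistics.

Section CDF.
Context {R : realType}.
Implicit Types (F Q : law R) (x : R).

Definition cdfr F x : R := fine (cdf_law F x).

Lemma cdf_lawE F x : cdf_law F x = F `]-oo, x]%classic.
Proof. by []. Qed.

Lemma cdfrK F x : (cdfr F x)%:E = F `]-oo, x]%classic.
Proof. by rewrite /cdfr cdf_lawE fineK// fin_num_measure. Qed.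

Lemma cdfr_ge0 F x : 0 <= cdfr F x.
Proof. by rewrite -lee_fin cdfrK. Qed.

Lemma cdfr_le1 F x : cdfr F x <= 1.
Proof. by rewrite -lee_fin cdfrK probability_le1. Qed.

Lemma cdfr01 F x : 0 <= cdfr F x <= 1.
Proof. by rewrite cdfr_ge0 cdfr_le1. Qed.

Lemma measurable_cdfr F D : measurable_fun D (cdfr F).
Proof.
apply: measurable_funTS; apply/measurable_EFinP.
apply: (eq_measurable_fun (cdf_law F)) => [x _ /=|]; last exact: cdf_measurable.
by rewrite cdf_lawE cdfrK.
Qed.

Lemma cdfr_tail F x : F `]x, +oo[%classic = (1 - cdfr F x)%:E.
Proof. by rewrite -setCitvl probability_setC// EFinB cdfrK. Qed.

End CDF.

(** * Laws of the two largest of n independent draws *)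

Section OrderStatisticLaws.
Context {R : realType}.
Variable F : law R.
Implicit Types (x : R) (n : nat).
Local Open Scope ereal_scope.

Lemma iid_order_stat0 n x : (0 < n)%N ->
  iid F n [set v | order_stat v 0 <= x]%R = (cdfr F x ^+ n)%:E.
Proof.
move=> n0; transitivity (iid F n [set v | forall i, `]-oo, x]%classic (tnth v i)]).
  congr (iid F n _); apply/seteqP; split=> v /=; rewrite order_stat0_le//.
    by move=> /forallP h i; rewrite in_itv/=.
  by move=> h; apply/forallP => i; have := h i; rewrite in_itv.
rewrite (@iid_box _ (measurableTypeR R) R F n (fun=> `]-oo, x]%classic))//.
under eq_bigr do rewrite -cdfrK.
by rewrite prodEFin prodr_const card_ord.
Qed.

Lemma iid_order_stat1 n x : (1 < n)%N ->
  iid F n [set v | order_stat v 1 <= x]%R = (1 - second_tail n (cdfr F x))%:E.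
Proof.
move=> n1; have n0 := ltnW n1.
(* The box where coordinate [i] alone exceeds [x]; its mass is (1 - f) f^(n-1) with f the cdf at
   [x]. *)
pose A (i : 'I_n) : set (n.-tuple (measurableTypeR R)) :=
  [set v | forall j, (if j == i then `]x, +oo[ else `]-oo, x])%classic (tnth v j)].
have mbox (B : 'I_n -> set (measurableTypeR R)) : (forall i, measurable (B i)) ->
    measurable [set v : n.-tuple _ | forall i, B i (tnth v i)].
  move=> mB; rewrite (_ : [set v | _] = \big[setI/setT]_(i < n)
      ((fun v : n.-tuple (measurableTypeR R) => tnth v i) @^-1` B i)).
    apply: bigsetI_measurable => i _.
    by rewrite -[X in measurable X]setTI; apply: measurable_tnth.
  rewrite -bigcap_seq; apply/seteqP; split => [v Bv i _|v Bv i] /=; first by apply: (Bv i).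
  by apply: (Bv i) => /=; rewrite mem_index_enum.
have mA i : measurable (A i) 
  by apply: (mbox (fun j => if j == i then `]x, +oo[ else `]-oo, x])%classic) => j;
    case: ifP.
have -> : [set v : n.-tuple R | order_stat v 1 <= x]%R =
    [set v | order_stat v 0 <= x]%R `|` \big[setU/set0]_(i < n) A i.
  rewrite -bigcup_seq; apply/seteqP; split=> v /=.
    rewrite order_stat1_le// -order_stat0_le// => /orP[|/existsP[i /andP[xi /forallP h]]].
      by left.
    right; exists i; first by rewrite /= mem_index_enum.
    move=> j /=; case: eqVneq => [->|ji]; first by rewrite /= in_itv/= xi.
    by rewrite /= in_itv/=; exact: (implyP (h j)).
  rewrite order_stat1_le// -order_stat0_le// => -[->//|[i _ Ai]].
  apply/orP; right; apply/existsP; exists i.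
  have := Ai i; rewrite eqxx /= in_itv/= andbT => -> /=.
  apply/forallP => j; apply/implyP => ji.
  by have := Ai j; rewrite (negbTE ji) /= in_itv.
transitivity (iid F n [set v | order_stat v 0 <= x]%R + \sum_(i < n) iid F n (A i)).
  rewrite measureU//; last 3 first.
  - rewrite (_ : [set v | _] = [set v | forall i, `]-oo, x]%classic (tnth v i)]); last first.
      apply/seteqP; split=> v /=; rewrite order_stat0_le//.
        by move=> /forallP h i; rewrite in_itv/=.
      by move=> h; apply/forallP => i; have := h i; rewrite in_itv.
    by apply: (mbox (fun=> `]-oo, x]%classic)).
  - by apply: bigsetU_measurable.
  - rewrite -subset0 => v [/=]; rewrite order_stat0_le// => /forallP h.
    rewrite -bigcup_seq => -[i _ /(_ i)]; rewrite eqxx /= in_itv/= andbT.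
    by rewrite ltNge h.
  congr (_ + _); apply: measure_semi_additive_ord => //.
    apply/trivIsetP => i j _ _ ij; rewrite -subset0 => v [/(_ i) + /(_ i)].
    rewrite eqxx (negbTE ij) /= !in_itv/= andbT => + /(lt_le_trans _).
    by move=> /[swap]/[apply]; rewrite ltxx.
  exact: bigsetU_measurable.
rewrite iid_order_stat0//.
transitivity ((cdfr F x ^+ n)%:E +
    \sum_(i < n) ((1 - cdfr F x) * cdfr F x ^+ n.-1)%:E); last first.
  rewrite sumEFin -EFinD sumr_const card_ord -mulr_natl /second_tail.
  congr EFin; case: n n1 {n0 A mbox mA} => // n _ /=.
  by rewrite -natr1 exprS; ring.
congr (_ + _); apply: eq_bigr => i _.
rewrite (@iid_box _ (measurableTypeR R) R F n
  (fun j => if j == i then `]x, +oo[ else `]-oo, x])%classic); last first.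
  by move=> j; case: ifP.
rewrite (bigD1 i)//= eqxx cdfr_tail (eq_bigr (fun=> (cdfr F x)%:E)); last first.
  by move=> j /negbTE ->; rewrite cdfrK.
by rewrite prodEFin prodr_const cardC1 card_ord.
Qed.

Lemma measurable_order_stat_gt n k x :
  measurable [set v : n.-tuple (measurableTypeR R) | x < order_stat v k]%R.
Proof.
have := @measurable_order_stat R n k measurableT _ (measurable_itv `]x, +oo[).
rewrite setTI; congr measurable.
by apply/seteqP; split => v; rewrite /= in_itv/= andbT.
Qed.

Lemma iid_order_stat_gt n k x :
  iid F n [set v | x < order_stat v k]%R =
  1 - iid F n [set v | order_stat v k <= x]%R.
Proof.
have -> : [set v : n.-tuple R | order_stat v k <= x]%R =
    ~` [set v : n.-tuple R | x < order_stat v k]%R.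
  by apply/seteqP; split=> v /=; rewrite leNgt => /negP.
have mE := @measurable_order_stat_gt n k x.
by rewrite probability_setC// oppeB ?fin_num_adde_defr// addeA subee// add0e.
Qed.

Lemma iid_order_stat0_gt n x : (0 < n)%N ->
  iid F n [set v | x < order_stat v 0]%R = (1 - cdfr F x ^+ n)%:E.
Proof. by move=> n0; rewrite iid_order_stat_gt iid_order_stat0. Qed.

Lemma iid_order_stat1_gt n x : (1 < n)%N ->
  iid F n [set v | x < order_stat v 1]%R = (second_tail n (cdfr F x))%:E.
Proof.
by move=> n1; rewrite iid_order_stat_gt iid_order_stat1// -EFinB subKr.
Qed.

End OrderStatisticLaws.

(** * Tonelli's theorem for weighted layers *)

Section LayerCake.
Context d (T : measurableType d) {R : realType} (P : probability T R).
Variables (A : set (T * measurableTypeR R)) (g : R -> R) (D : set R).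
Hypotheses (mA : measurable A) (mD : measurable D).
Hypotheses (mg : measurable_fun setT g) (g0 : forall t, 0 <= g t).
Local Open Scope ereal_scope.
Let leb := @lebesgue_measure R.

(** Extending [g] by 0 outside [D] puts the inner integral on the whole line, so that Tonelli
    applies to a product of full spaces. *)
Let f (p : T * measurableTypeR R) : \bar R := ((g \_ D) p.2 * \1_A p)%:E.

Let f_ge0 p : 0 <= f p.
Proof.
by rewrite lee_fin mulr_ge0// patchE; case: ifP.
Qed.

Let mf : measurable_fun setT f.
Proof.
apply/measurable_EFinP/measurable_funM; last exact: measurable_indic.
apply: measurableT_comp => //.
by have [h _] := measurable_restrictT g mD; apply: h; exact: measurable_funTS.
Qed.

Let fE w : \int[leb]_(t in D) (g t * \1_A (w, t))%:E = \int[leb]_t f (w, t).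
Proof.
rewrite integral_mkcond; apply: eq_integral => t _.
by rewrite /f /= !patchE; case: ifP; rewrite // mul0r.
Qed.

Lemma measurable_layer_cake :
  measurable_fun setT (fun w => \int[leb]_(t in D) (g t * \1_A (w, t))%:E).
Proof.
under eq_fun do rewrite fE.
exact: (@measurable_fun_fubini_tonelli_F _ _ _ _ _ leb f).
Qed.

Lemma layer_cake : \int[P]_w \int[leb]_(t in D) (g t * \1_A (w, t))%:E =
  \int[leb]_(t in D) ((g t)%:E * P [set w | A (w, t)]).
Proof.
under eq_integral do rewrite fE.
rewrite (fubini_tonelli f)// [RHS]integral_mkcond; apply: eq_integral => t _.
rewrite /f /= !patchE; case: ifP => tD; last first.
  by under eq_integral do rewrite mul0r; rewrite integral0.
have mAt : measurable [set w | A (w, t)].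
  have := measurable_ysection t mA; congr measurable.
  by apply/seteqP; split => w; rewrite ysectionE.
under eq_integral do rewrite EFinM.
rewrite ge0_integralZl//; last 2 first.
- apply/measurable_EFinP.
  rewrite (_ : (fun w => _) = \1_[set w | A (w, t)]); first exact: measurable_indic.
  by apply/funext => w; rewrite !indicE; congr (nat_of_bool _)%:R;
     apply/idP/idP; rewrite !inE.
- by rewrite lee_fin.
rewrite (eq_integral (fun w => (\1_[set w | A (w, t)] w)%:E)).
  by rewrite integral_indic// setIT.
by move=> w _; rewrite !indicE; congr ((nat_of_bool _)%:R%:E);
     apply/idP/idP; rewrite !inE.
Qed.

End LayerCake.

Section Intervals.
Context {R : realType}.
Implicit Types (a b x : R).

Lemma integral_cst_itv (l0 l1 : bool) a b x : a <= b ->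
  (\int[@lebesgue_measure R]_(t in [set` Interval (BSide l0 a) (BSide l1 b)]) x%:E
   = (x * (b - a))%:E)%E.
Proof.
rewrite integral_cst//= lebesgue_measure_itv/= lte_fin le_eqVlt.
by move=> /predU1P[->|->//]; rewrite ltxx subrr mulr0 mule0.
Qed.

End Intervals.

(** * Revenue at a fixed reserve *)

Section Revenue.
Context {R : realType}.
Implicit Types (F Q : law R) (x r b : R) (n : nat).
Local Open Scope ereal_scope.
Local Notation leb := (@lebesgue_measure R).
Local Notation tuR n := (n.-tuple (measurableTypeR R)).

Lemma measurable_lt_order_stat n k :
  measurable [set p : tuR n * measurableTypeR R | p.2 < order_stat p.1 k]%R.
Proof.
have mk : measurable_fun setT (fun p : tuR n * measurableTypeR R => (order_stat p.1 k : R)).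
  apply: (measurableT_comp (f := fun v : n.-tuple R => order_stat v k)).
    exact: measurable_order_stat.
  exact: measurable_fst.
have m2 : measurable_fun setT (fun p : tuR n * measurableTypeR R => (p.2 : R)).
  exact: measurable_snd.
have /(_ measurableT [set true] I) := measurable_fun_ltr m2 mk.
by rewrite setTI; congr measurable.
Qed.

Lemma measurable_le_snd :
  measurable [set p : measurableTypeR R * measurableTypeR R | (p.1 : R) <= p.2]%R.
Proof.
have m1 : measurable_fun setT (fun p : measurableTypeR R * measurableTypeR R => (p.1 : R)).
  exact: measurable_fst.
have m2 : measurable_fun setT (fun p : measurableTypeR R * measurableTypeR R => (p.2 : R)).
  exact: measurable_snd.
have /(_ measurableT [set true] I) := measurable_fun_ler m1 m2.
by rewrite setTI; congr measurable.
Qed.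

Lemma measurable_revenue n :
  measurable_fun setT (fun p : measurableTypeR R * tuR n => (revenue (p.1 : R) p.2 : R)).
Proof.
have m1 : measurable_fun setT (fun p : measurableTypeR R * tuR n => (p.1 : R)).
  exact: measurable_fst.
have mk k : measurable_fun setT (fun p : measurableTypeR R * tuR n => (order_stat p.2 k : R)).
  apply: (measurableT_comp (f := fun v : n.-tuple R => order_stat v k)).
    exact: measurable_order_stat.
  exact: measurable_snd.
apply: measurable_fun_ifT; [exact: measurable_fun_ltr|exact: measurable_maxr|].
exact: measurable_cst.
Qed.

Lemma measurable_Rev n F : measurable_fun setT (Rev n F).
Proof.
pose f (p : measurableTypeR R * tuR n) := (revenue (p.1 : R) p.2)%:E.
have mf : measurable_fun setT f by apply/measurable_EFinP; exact: measurable_revenue.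
(* Negative reserves and values can make the revenue negative, while Tonelli measurability concerns
   nonnegative integrands; hence the two parts. *)
rewrite (_ : Rev n F = fun r => \int[iid F n]_v (f^\+ (r, v)) - \int[iid F n]_v (f^\- (r, v))).
  apply: emeasurable_funB.
    apply: (@measurable_fun_fubini_tonelli_F _ _ _ _ _ (iid F n) f^\+) => //.
    exact: measurable_funepos.
  apply: (@measurable_fun_fubini_tonelli_F _ _ _ _ _ (iid F n) f^\-) => //.
  exact: measurable_funeneg.
apply/funext => r; rewrite /Rev unlock integralE.
by congr (_ - _); apply: eq_integral => v _; rewrite ?funeposE ?funenegE.
Qed.

Lemma integral_indic_itv r x : (0 <= r)%R ->
  \int[leb]_(t in `[0%R, +oo[) (\1_`[r, +oo[ t * (t < x)%R%:R)%:E
  = (Num.max (x - r) 0)%:E.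
Proof.
move=> r0; transitivity (\int[leb]_t (\1_`[r, x[ t)%:E); last first.
  rewrite integral_indic//= setIT lebesgue_measure_itv/= lte_fin.
  by case: ltP => rx; [rewrite max_l|rewrite max_r] => //; lra.
rewrite integral_mkcond; apply: eq_integral => t _.
rewrite patchE !indicE; case: ifPn => [|]; rewrite ?inE ?notin_setE/= in_itv/= andbT.
  move=> t0; rewrite !mem_setE !in_itv/= andbT.
  by rewrite -natrM mulnb.
move=> /negP; rewrite -ltNge => t0; rewrite mem_setE in_itv/=.
by rewrite (leNgt r) (lt_le_trans t0 r0).
Qed.

Lemma revenueE n r (v : tuR n) : (1 < n)%N -> (0 <= r)%R ->
  (revenue r v)%:E = (r * (r < order_stat v 0)%R%:R)%:E +
    \int[leb]_(t in `[0%R, +oo[) (\1_`[r, +oo[ t *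
      \1_[set p : tuR n * measurableTypeR R | p.2 < order_stat p.1 1]%R (v, t))%:E.
Proof.
move=> n1 r0.
transitivity ((r * (r < order_stat v 0)%R%:R)%:E + \int[leb]_(t in `[0%R, +oo[)
   (\1_`[r, +oo[ t * (t < order_stat v 1)%R%:R)%:E); last first.
  congr (_ + _); apply: eq_integral => t _; congr (_ * _)%:E.
  rewrite indicE; congr (nat_of_bool _)%:R.
  by apply/idP/idP; rewrite inE.
rewrite integral_indic_itv// -EFinD /revenue.
(* If nothing is sold, the second value is at most [r] as well, and the integral vanishes. *)
have h := order_stat_ge v n1.
case: ltP => rv; congr EFin.
  by rewrite mulr1 addr_maxr addr0 addrCA subrr addr0 maxC.
by rewrite mulr0 add0r max_r//; lra.
Qed.

Lemma RevE n F r : (1 < n)%N -> (0 <= r)%R ->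
  Rev n F r = (r * (1 - cdfr F r ^+ n))%:E +
    \int[leb]_(t in `[0%R, +oo[) (\1_`[r, +oo[ t * second_tail n (cdfr F t))%:E.
Proof.
move=> n1 r0; rewrite /Rev unlock.
pose A := [set p : tuR n * measurableTypeR R | p.2 < order_stat p.1 1]%R.
transitivity (\int[iid F n]_v ((r * (r < order_stat v 0)%R%:R)%:E +
    \int[leb]_(t in `[0%R, +oo[) (\1_`[r, +oo[ t * \1_A (v, t))%:E)).
  by apply: eq_integral => v _; exact: revenueE.
have mg : measurable_fun setT (\1_`[r, +oo[%classic : R -> R) by exact: measurable_indic.
have mA : measurable A by exact: measurable_lt_order_stat.
have m0 := @measurable_order_stat_gt _ n 0 r.
have rE (v : tuR n) : (r < order_stat v 0)%R%:R = \1_[set v | r < order_stat v 0]%R v :> R.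
  by rewrite indicE; congr (nat_of_bool _)%:R; apply/idP/idP; rewrite inE.
rewrite ge0_integralD//=; last 4 first.
- by move=> v _; rewrite lee_fin mulr_ge0.
- apply/measurable_EFinP/measurable_funM => //.
  by under eq_fun do rewrite rE; exact: measurable_indic.
- by move=> v _; apply: integral_ge0 => t _; rewrite lee_fin mulr_ge0.
- by apply: measurable_layer_cake.
congr (_ + _).
  under eq_integral do rewrite rE EFinM.
  rewrite ge0_integralZl//; last exact/measurable_EFinP/measurable_indic.
  rewrite integral_indic// setIT EFinM; congr (_ * _).
  exact: (iid_order_stat0_gt F r (ltnW n1)).
rewrite layer_cake//; apply: eq_integral => t _.
by rewrite EFinM; congr (_ * _); exact: (iid_order_stat1_gt F t n1).
Qed.

End Revenue.

(** * Laws supported in [0, b]: atoms and the mean *)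

Section Supported.
Context {R : realType}.
Implicit Types (F Q : law R) (x t b : R) (n : nat).
Local Open Scope ereal_scope.
Local Notation leb := (@lebesgue_measure R).

Lemma supported_cdfr1 b F x : supported b F -> (b <= x)%R -> cdfr F x = 1%R.
Proof.
move=> sF bx; apply/eqP; rewrite eq_le cdfr_le1 -lee_fin cdfrK.
rewrite (_ : 1%:E = F `[0%R, b]%classic); last by rewrite sF.
apply: le_measure; rewrite ?inE//.
by move=> y /=; rewrite !in_itv/= => /andP[_ yb]; exact: le_trans bx.
Qed.

Lemma supported_setC b F : supported b F -> F (~` `[0%R, b]%classic) = 0.
Proof.
move=> sF; rewrite probability_setC; last exact: measurable_itv.
by rewrite sF subee.
Qed.

(** Continuity from below along t - 1/(k+1). It turns the left limit of a cdf formula into the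
    absence of an atom, or of mass below 0. *)
Lemma cdfr_left F t l : cdfr F x @[x --> t^'-] --> l -> F `]-oo, t[%classic = l%:E.
Proof.
move=> Fl; pose u k := (t - k.+1%:R^-1)%R.
have ut k : (u k < t)%R by rewrite /u ltrBlDr ltrDl invr_gt0.
have cu : u @ \oo --> t.
  rewrite -[X in _ --> X]subr0; apply: cvgB; first exact: cvg_cst.
  exact: cvg_harmonic.
have lim1 : F `]-oo, u k]%classic @[k --> \oo] --> l%:E.
  under eq_fun do rewrite -cdfrK; apply: cvg_EFin; first exact: nearW.
  by apply: (cvg_at_leftP _ _ _).1 Fl _ _; split.
have lim2 : F `]-oo, u k]%classic @[k --> \oo] --> F (\bigcup_k `]-oo, u k]%classic).
  apply: nondecreasing_cvg_mu => //; first exact: bigcup_measurable.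
  move=> i j ij; apply/subsetPset => y /=; rewrite !in_itv/= => /le_trans; apply.
  by rewrite /u lerD2l lerN2 lef_pV2 ?posrE// ler_nat.
rewrite -(cvg_unique _ lim2 lim1)//; congr (F _).
apply/seteqP; split => y /=; rewrite in_itv/=; last first.
  by move=> [k _ /=]; rewrite in_itv/= => /le_lt_trans; apply.
move=> yt; have ty : (0 < t - y)%R by rewrite subr_gt0.
have [k] : exists k, (k.+1%:R^-1 < t - y)%R.
  have := near_infty_natSinv_lt (PosNum ty) => -[k _ /(_ k)] /=.
  by move=> /(_ (leqnn _)) h; exists k.
by move=> h; exists k => //=; rewrite in_itv/= /u lerBrDr -lerBrDl ltW.
Qed.

Lemma supported_cdfr b F : (0 <= b)%R -> cdfr F b = 1%R ->
  (forall x, (x < 0)%R -> cdfr F x = 0%R) -> supported b F.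
Proof.
move=> b0 Fb F0; rewrite /supported.
have F0' : F `]-oo, 0%R[%classic = 0.
  rewrite (@cdfr_left F 0%R 0%R)//; apply: cvg_near_cst.
  by near=> x; apply/F0.
have -> : `[0%R, b]%classic = `]-oo, b] `\` `]-oo, 0%R[.
  apply/seteqP; split => y /=; rewrite !in_itv/=.
    by move=> /andP[y0 yb]; split => //; apply/negP; rewrite -leNgt.
  by move=> [yb /negP]; rewrite -leNgt => ->.
rewrite measureD//=; last by rewrite -ge0_fin_numE// fin_num_measure.
rewrite -cdfrK Fb setIidr ?F0' ?sube0//.
by move=> y /=; rewrite !in_itv/= => /ltW/le_trans; apply.
Unshelve. all: by end_near. Qed.

Lemma integral_itv_bounded b (h : R -> \bar R) : (0 <= b)%R ->
  (forall t, (b <= t)%R -> h t = 0) ->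
  \int[leb]_(t in `[0%R, +oo[) h t = \int[leb]_(t in `[0%R, b[) h t.
Proof.
move=> b0 h0; rewrite integral_mkcond [RHS]integral_mkcond.
apply: eq_integral => t _; rewrite !patchE !mem_setE !in_itv/= andbT.
by case: (leP 0%R t) => //= t0; case: ltP => // /h0.
Qed.

Lemma mean_cdfr b F : (0 <= b)%R -> supported b F ->
  'E_F[idTR] = \int[leb]_(t in `[0%R, b[) (1 - cdfr F t)%:E.
Proof.
move=> b0 sF; rewrite unlock.
pose A := [set p : measurableTypeR R * measurableTypeR R | p.2 < p.1]%R.
have mA : measurable A.
  have m1 : measurable_fun setT (fun p : measurableTypeR R * measurableTypeR R => (p.1 : R)).
    exact: measurable_fst.
  have m2 : measurable_fun setT (fun p : measurableTypeR R * measurableTypeR R => (p.2 : R)).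
    exact: measurable_snd.
  have /(_ measurableT [set true] I) := measurable_fun_ltr m2 m1.
  by rewrite setTI; congr measurable.
have mg : measurable_fun setT (\1_`[0%R, +oo[%classic : R -> R) by exact: measurable_indic.
transitivity (\int[F]_x \int[leb]_(t in `[0%R, +oo[)
    (\1_`[0%R, +oo[ t * \1_A (x, t))%:E).
  (* For negative x the layers give 0 instead of x, so the integrands agree only almost
     everywhere. *)
  apply: ae_eq_integral => //.
  - exact/measurable_EFinP/measurable_id.
  - exact: measurable_layer_cake.
  exists (~` `[0%R, b]%classic); split.
  - by apply: measurableC; exact: measurable_itv.
  - exact: supported_setC.
  - apply: subsetC => x /=; rewrite in_itv/= => /andP[x0 xb] _.
    transitivity (\int[leb]_(t in `[0%R, +oo[) (\1_`[0%R, +oo[ t * (t < x)%R%:R)%:E).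
      by rewrite integral_indic_itv// subr0 max_l.
    apply: eq_integral => t _; congr (_ * _)%:E; rewrite indicE.
    by congr (nat_of_bool _)%:R; apply/idP/idP; rewrite inE.
rewrite layer_cake// -integral_itv_bounded//; last first.
  by move=> t bt; rewrite (supported_cdfr1 sF bt) subrr.
apply: eq_integral => t; rewrite inE/= in_itv/= andbT => t0.
rewrite indicE mem_setE in_itv/= t0 mul1e -cdfr_tail; congr (F _).
by apply/seteqP; split => x /=; rewrite in_itv/= andbT.
Qed.

End Supported.

(** * Revenue under a random reserve *)

Section ReserveDistribution.
Context {R : realType}.
Variables (n : nat) (b : R) (Q : law R) (s : R -> R).
Hypotheses (n1 : (1 < n)%N) (b0 : 0 < b) (sQ : supported b Q).
Hypotheses (ms : measurable_fun setT s) (s0 : forall x, 0 <= s x).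
Implicit Types (F : law R) (t r x : R).
Local Open Scope ereal_scope.
Local Notation leb := (@lebesgue_measure R).
Hypothesis Qatom : forall t, (0 < t <= b)%R -> Q `]-oo, t[%classic = (cdfr Q t)%:E.
Hypothesis Qs : forall t, (0 < t <= b)%R ->
  \int[leb]_(x in `[0%R, t[) (cdfr Q x + s x)%:E = (t * cdfr Q t)%:E.

Let measurable_cdfr_EFin D : measurable_fun D (fun x => (cdfr Q x)%:E).
Proof. by apply/measurable_EFinP; exact: measurable_cdfr. Qed.

Let measurable_s_EFin D : measurable_fun D (fun x => (s x)%:E).
Proof. by apply/measurable_EFinP; exact: measurable_funTS. Qed.

(** Integration by parts without a density: adding the integral of the cdf of [Q], which is finite
    and can be cancelled, turns both sides into t Q(t). *)
Let integral_gap t : (0 < t <= b)%R ->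
  \int[leb]_(x in `[0%R, t[) (cdfr Q t - cdfr Q x)%:E
  = \int[leb]_(x in `[0%R, t[) (s x)%:E.
Proof.
move=> tb; have t0 : (0 <= t)%R by case/andP: tb => /ltW.
have Qmono x : (x < t)%R -> (cdfr Q x <= cdfr Q t)%R.
  move=> xt; rewrite -lee_fin !cdfrK le_measure ?inE//.
  by move=> y /=; rewrite !in_itv/= => /le_trans; apply; exact: ltW.
have fin : \int[leb]_(x in `[0%R, t[) (cdfr Q x)%:E \is a fin_num.
  rewrite ge0_fin_numE; last by apply: integral_ge0 => x _; rewrite lee_fin cdfr_ge0.
  apply: (@le_lt_trans _ _ (\int[leb]_(x in `[0%R, t[) (cst 1 x))).
    apply: ge0_le_integral => //.
    - by move=> x _; rewrite lee_fin cdfr_ge0.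
    - exact: measurable_cdfr_EFin.
    - by move=> x _; rewrite lee_fin cdfr_le1.
  by rewrite integral_cst_itv// ltry.
rewrite -[LHS](addeK _ fin) -[RHS](addeK _ fin); congr (_ - _).
have Q0 x : `[0%R, t[%classic x -> 0 <= (cdfr Q x)%:E by rewrite lee_fin cdfr_ge0.
have S0 x : `[0%R, t[%classic x -> 0 <= (s x)%:E by rewrite lee_fin.
have G0 x : `[0%R, t[%classic x -> 0 <= (cdfr Q t - cdfr Q x)%:E.
  by rewrite /= in_itv/= => /andP[_ /Qmono]; rewrite lee_fin subr_ge0.
have mG : measurable_fun `[0%R, t[ (fun x => (cdfr Q t - cdfr Q x)%:E).
  by apply/measurable_EFinP/measurable_funB => //; exact: measurable_cdfr.
have mQ : measurable_fun `[0%R, t[ (fun x => (cdfr Q x)%:E) by exact: measurable_cdfr_EFin.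
have mS : measurable_fun `[0%R, t[ (fun x => (s x)%:E) by exact: measurable_s_EFin.
rewrite -(ge0_integralD leb _ G0 mG Q0 mQ)// -(ge0_integralD leb _ S0 mS Q0 mQ)//.
transitivity (\int[leb]_(x in `[0%R, t[) (cdfr Q t)%:E).
  by apply: eq_integral => x _; rewrite -EFinD subrK.
rewrite integral_cst_itv// subr0 mulrC -Qs//.
by apply: eq_integral => x _; rewrite EFinD addeC.
Qed.

(** The part r 1[v1 > r] of the revenue when the highest value is [t]; clamping negative [r], a null
    set for [Q], keeps it nonnegative for Tonelli. *)
Let X (t r : R) : R := (if r < t then Num.max r 0 else 0)%R.

Let measurable_gap t :
  measurable [set p : measurableTypeR R * measurableTypeR R | p.2 < p.1 < t]%R.
Proof.
have m1 : measurable_fun setT (fun p : measurableTypeR R * measurableTypeR R => (p.1 : R)).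
  exact: measurable_fst.
have m2 : measurable_fun setT (fun p : measurableTypeR R * measurableTypeR R => (p.2 : R)).
  exact: measurable_snd.
have /(_ measurableT [set true] I) h1 := measurable_fun_ltr m2 m1.
have /(_ measurableT [set true] I) h2 := measurable_fun_ltr m1 (measurable_cst t).
have := measurableI _ _ h1 h2; rewrite !setTI; congr measurable.
by apply/seteqP; split => p /= => [[-> ->]|/andP].
Qed.

(** By layers the left-hand side integrates Q(x < r < t) over x, and without atoms this is Q(t) -
    Q(x). On the right t remains only in the indicator of x < t, whose mean over the highest value t
    is 1 - F(x)^n. *)
Lemma integral_reserve_lt t :
  \int[Q]_r (X t r)%:E = \int[leb]_(x in `[0%R, b[) (s x * (x < t)%R%:R)%:E.
Proof.
pose A := [set p : measurableTypeR R * measurableTypeR R | p.2 < p.1 < t]%R.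
have mA : measurable A by exact: measurable_gap.
have mg : measurable_fun setT (\1_`[0%R, +oo[%classic : R -> R) by exact: measurable_indic.
transitivity (\int[Q]_r \int[leb]_(x in `[0%R, +oo[)
    (\1_`[0%R, +oo[ x * \1_A (r, x))%:E).
  apply: eq_integral => r _; rewrite /X; case: ifPn => rt.
    rewrite -[in LHS](subr0 r) -integral_indic_itv//; apply: eq_integral => x _.
    congr (_ * _)%:E; rewrite indicE; congr (nat_of_bool _)%:R.
    by apply/idP/idP; rewrite inE /A /= rt andbT.
  rewrite integral0_eq// => x _; rewrite [X in (_ * X)%R]indicE memNset ?mulr0//.
  by rewrite /A /= (negbTE rt) andbF.
rewrite layer_cake//.
have [t0|t0] := leP t 0%R.
  rewrite !integral0_eq// => x /=; rewrite in_itv/= ?andbT.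
    by move=> /andP[x0 _]; rewrite ltNge (le_trans t0 x0) mulr0.
  move=> x0; rewrite (_ : [set w | A (w, x)] = set0) ?measure0 ?mule0//.
  rewrite -subset0 => r /= /andP[xr rt].
  by have := lt_trans (le_lt_trans x0 xr) (lt_le_trans rt t0); rewrite ltxx.
(* [Qatom] and [Qs] speak of levels up to [b] only; above [b] the cdf of [Q] stays at 1. *)
pose u := Num.min t b.
have ub : (0 < u <= b)%R by rewrite lt_min t0 b0 ge_min lexx orbT.
have Qt : Q `]-oo, t[%classic = (cdfr Q u)%:E.
  have [tb|bt] := leP t b; first by rewrite /u min_l// Qatom// t0.
  rewrite /u min_r ?ltW// (supported_cdfr1 sQ (lexx b)).
  apply/eqP; rewrite eq_le probability_le1//=.
  rewrite -(supported_cdfr1 sQ (lexx b)) cdfrK le_measure ?inE//.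
  by move=> y /=; rewrite !in_itv/= => /le_lt_trans; apply.
transitivity (\int[leb]_(x in `[0%R, u[) (cdfr Q u - cdfr Q x)%:E).
  rewrite integral_mkcond [RHS]integral_mkcond; apply: eq_integral => x _.
  rewrite !patchE !mem_setE !in_itv/= andbT.
  have [x0|//] := leP 0%R x; rewrite indicE mem_setE in_itv/= x0 mul1e.
  case: ifPn => [xu|].
    have -> : [set w | A (w, x)] = `]-oo, t[ `\` `]-oo, x].
      apply/seteqP; split => r /=; rewrite !in_itv/=.
        by move=> /andP[xr rt]; split => //; apply/negP; rewrite -ltNge.
      by move=> [rt /negP]; rewrite -ltNge => xr; apply/andP.
    rewrite measureD//=; last by rewrite -ge0_fin_numE// fin_num_measure.
    rewrite setIidr ?Qt -?cdfrK -?EFinB// => y /=; rewrite !in_itv/=.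
    by move=> /le_lt_trans; apply; move: xu; rewrite /u lt_min => /andP[].
  rewrite -leNgt /u ge_min => /orP[tx|bx].
    rewrite (_ : [set w | A (w, x)] = set0) ?measure0// -subset0 => r /= /andP[xr rt].
    by have := lt_le_trans (lt_trans xr rt) tx; rewrite ltxx.
  apply/eqP; rewrite eq_le measure_ge0 andbT.
  apply: (@le_trans _ _ (Q (~` `[0%R, b]%classic))); last by rewrite supported_setC.
  apply: le_measure; rewrite ?inE.
  - rewrite (_ : [set w | A (w, x)] = `]x, t[%classic); first exact: measurable_itv.
    by apply/seteqP; split => r; rewrite /= in_itv.
  - by apply: measurableC; exact: measurable_itv.
  - move=> r /= /andP[xr _]; rewrite in_itv/= => /andP[_ rb].
    by have := lt_le_trans (le_lt_trans bx xr) rb; rewrite ltxx.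
rewrite integral_gap// integral_mkcond [RHS]integral_mkcond; apply: eq_integral => x _.
rewrite !patchE !mem_setE !in_itv/= /u lt_min.
by case: (leP 0%R x); case: ltP; case: ltP => //=; rewrite ?mulr1 ?mulr0.
Qed.

Let B := [set p : measurableTypeR R * measurableTypeR R | (p.1 : R) <= p.2]%R.

Let measurable_tail F : measurable_fun setT (fun t : R => second_tail n (cdfr F t)).
Proof.
by apply: measurable_funD; [apply: measurable_funB => //|];
  apply: measurable_funM => //; apply: measurable_funX; exact: measurable_cdfr.
Qed.

Let tail_ge0 F t : (0 <= second_tail n (cdfr F t))%R.
Proof. by rewrite second_tail_ge0// cdfr01. Qed.

Let Rev_supported F r : supported b F -> (0 <= r)%R ->
  Rev n F r = (Num.max r 0%R * (1 - cdfr F r ^+ n))%:E +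
    \int[leb]_(t in `[0%R, b[) (second_tail n (cdfr F t) * \1_B (r, t))%:E.
Proof.
move=> sF r0; rewrite RevE// max_l//; congr (_ + _).
rewrite (@integral_itv_bounded _ b) ?ltW//; last first.
  move=> t bt; rewrite (supported_cdfr1 sF bt) /second_tail !expr1n !mulr1.
  rewrite (_ : 1 - n%:R + n.-1%:R = 0)%R ?mulr0//.
  by rewrite -[in n%:R](prednK (ltnW n1)) -natr1; ring.
apply: eq_integral => t _; rewrite mulrC; congr (_ * _)%:E.
rewrite !indicE; congr (nat_of_bool _)%:R.
by rewrite mem_setE in_itv/= andbT; apply/idP/idP; rewrite inE.
Qed.

Lemma RevQE F : supported b F -> RevQ n F Q =
  \int[leb]_(t in `[0%R, b[)
    (s t * (1 - cdfr F t ^+ n) + cdfr Q t * second_tail n (cdfr F t))%:E.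
Proof.
move=> sF.
have mB : measurable B by exact: measurable_le_snd.
have mpos : measurable_fun setT (fun r : R => Num.max r 0)%R by exact: measurable_maxr.
have mF : measurable_fun setT (fun t : R => 1 - cdfr F t ^+ n)%R.
  by apply: measurable_funB => //; apply: measurable_funX; exact: measurable_cdfr.
have F0 t : (0 <= 1 - cdfr F t ^+ n)%R.
  by rewrite subr_ge0 exprn_ile1// ?cdfr_ge0 ?cdfr_le1.
have mlc := measurable_layer_cake mB (measurable_itv `[0%R, b[) (measurable_tail F) (tail_ge0 F).
transitivity (\int[Q]_r ((Num.max r 0%R * (1 - cdfr F r ^+ n))%:E +
    \int[leb]_(t in `[0%R, b[) (second_tail n (cdfr F t) * \1_B (r, t))%:E)).
  apply: ae_eq_integral => //.
  - exact: measurable_Rev.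
  - by apply: emeasurable_funD => //; apply/measurable_EFinP/measurable_funM.
  exists (~` `[0%R, b]%classic); split.
  - by apply: measurableC; exact: measurable_itv.
  - exact: supported_setC.
  - apply: subsetC => r /=; rewrite in_itv/= => /andP[r0 rb] _.
    exact: Rev_supported.
rewrite ge0_integralD//; last 3 first.
- by move=> r _; rewrite lee_fin mulr_ge0// le_max lexx orbT.
- exact/measurable_EFinP/measurable_funM.
- by move=> r _; apply: integral_ge0 => t _; rewrite lee_fin mulr_ge0.
rewrite layer_cake//.
pose A := [set p : n.-tuple (measurableTypeR R) * measurableTypeR R | p.2 < order_stat p.1 0]%R.
have mA : measurable A by exact: measurable_lt_order_stat.
transitivity (\int[leb]_(t in `[0%R, b[) ((s t)%:E * iid F n [set v | A (v, t)]) +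
    \int[leb]_(t in `[0%R, b[) ((second_tail n (cdfr F t))%:E * Q [set w | B (w, t)])).
  congr (_ + _); rewrite -layer_cake//.
  pose C := [set p : measurableTypeR R * n.-tuple (measurableTypeR R) |
    (p.1 : R) < order_stat p.2 0]%R.
  have mC : measurable C.
    have m1 : measurable_fun setT (fun p : measurableTypeR R *
        n.-tuple (measurableTypeR R) => (p.1 : R)) by exact: measurable_fst.
    have m2 : measurable_fun setT (fun p : measurableTypeR R *
        n.-tuple (measurableTypeR R) => order_stat p.2 0).
      apply: (measurableT_comp (f := fun v : n.-tuple R => order_stat v 0)).
        exact: measurable_order_stat.
      exact: measurable_snd.
    have /(_ measurableT [set true] I) := measurable_fun_ltr m1 m2.
    by rewrite setTI; congr measurable.
  pose f (p : measurableTypeR R * n.-tuple (measurableTypeR R)) :=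
    (Num.max (p.1 : R) 0%R * \1_C p)%:E.
  have indicC r (v : n.-tuple (measurableTypeR R)) :
      \1_C (r, v) = \1_[set v : n.-tuple (measurableTypeR R) | r < order_stat v 0]%R v :> R.
    by rewrite !indicE; congr (nat_of_bool _)%:R; apply/idP/idP; rewrite !inE.
  transitivity (\int[Q]_r \int[iid F n]_v f (r, v)).
    apply: eq_integral => r _; rewrite /f/=.
    have m0 := @measurable_order_stat_gt _ n 0 r.
    under [RHS]eq_integral do rewrite indicC EFinM.
    rewrite ge0_integralZl//; last 2 first.
    - exact/measurable_EFinP/measurable_indic.
    - by rewrite lee_fin le_max lexx orbT.
    rewrite integral_indic// setIT EFinM; congr (_ * _).
    exact/esym/(iid_order_stat0_gt F r (ltnW n1)).
  (* The reserve is averaged first, with the values fixed, so that [integral_reserve_lt] applies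
     with t the highest value. *)
  rewrite (fubini_tonelli f); last 2 first.
  - apply/measurable_EFinP/measurable_funM; last exact: measurable_indic.
    by apply: measurable_maxr => //; exact: measurable_fst.
  - by move=> p; rewrite lee_fin mulr_ge0// le_max lexx orbT.
  apply: eq_integral => v _; rewrite /f /=.
  transitivity (\int[Q]_r (X (order_stat v 0) r)%:E).
    apply: eq_integral => r _; rewrite indicC indicE /X.
    have [rv|rv] := ltP r (order_stat v 0); first by rewrite mem_set// mulr1.
    by rewrite memNset ?mulr0//= ltNge rv.
  rewrite integral_reserve_lt; apply: eq_integral => t _; congr (_ * _)%:E.
  by rewrite indicE; congr (nat_of_bool _)%:R; apply/idP/idP; rewrite inE.
transitivity (\int[leb]_(t in `[0%R, b[) (s t * (1 - cdfr F t ^+ n))%:E +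
    \int[leb]_(t in `[0%R, b[) (cdfr Q t * second_tail n (cdfr F t))%:E).
  congr (_ + _); apply: eq_integral => t _; rewrite EFinM.
    by congr (_ * _); exact: (iid_order_stat0_gt F t (ltnW n1)).
  rewrite muleC; congr (_ * _); rewrite cdfrK; congr (Q _).
rewrite -ge0_integralD//.
- by move=> t _; rewrite lee_fin mulr_ge0.
- by apply/measurable_EFinP/measurable_funTS/measurable_funM.
- by move=> t _; rewrite lee_fin mulr_ge0// cdfr_ge0.
- apply/measurable_EFinP/measurable_funM; first exact: measurable_cdfr.
  by apply: measurable_funTS; exact: measurable_tail.
Qed.

End ReserveDistribution.

(** * From a cdf to a law *)

Section LawOfCDF.
Context {R : realType}.
Implicit Types (f g : R -> R) (b c x : R).

(** The switch [y < c] leaves the point [c] to the piece on its right, so a jump at [c] does not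
    disturb right continuity. *)
Lemma cvg_at_right_if f g c x :
  (x < c -> f y @[y --> x^'+] --> f x) -> (c <= x -> g y @[y --> x^'+] --> g x) ->
  (if y < c then f y else g y) @[y --> x^'+] --> (if x < c then f x else g x).
Proof.
move=> fx gx; case: ltP => xc.
  apply: cvg_trans (fx xc); apply: near_eq_cvg; near=> y.
  by rewrite ifT//; near: y; exact: nbhs_right_lt.
apply: cvg_trans (gx xc); apply: near_eq_cvg; near=> y.
rewrite ifF//; apply/negbTE; rewrite -leNgt (le_trans xc)// ltW//.
Unshelve. all: by end_near. Qed.

Lemma law_of_cdf f b : {homo f : x y / x <= y} ->
  (forall x, f y @[y --> x^'+] --> f x) ->
  (forall x, x < 0 -> f x = 0) -> (forall x, b <= x -> f x = 1) ->
  exists F : law R, forall x, cdf_law F x = (f x)%:E.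
Proof.
move=> f_nd f_rc f0 f1.
have fNy : f @ -oo --> (0 : R).
  by apply: cvg_near_cst; near=> x; apply: f0; near: x; apply: nbhs_ninfty_lt; exact: num_real.
have fy : f @ +oo --> (1 : R).
  by apply: cvg_near_cst; near=> x; apply: f1; near: x; apply: nbhs_pinfty_ge; exact: num_real.
pose F : cumulativeBounded (0 : R) (1 : R) := HB.pack f
  (isCumulative.Build R _ R f f_nd f_rc) (isCumulativeBounded.Build R 0 1 f fNy fy).
exists (lebesgue_stieltjes_measure F) => x.
exact: (cdf_lebesgue_stieltjes_id F).
Unshelve. all: by end_near. Qed.

End LawOfCDF.

(** * Integrals over half-open intervals *)

Section Integrals.
Context {R : realType}.
Implicit Types (f F : R -> R) (a b c t x : R).
Local Notation leb := (@lebesgue_measure R).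

(** Derivatives are required from some [c < a] on, so that [F] and [f] are continuous on both sides
    of the endpoint [a]. *)
Lemma integral_derive f F c a t : c < a -> a <= t ->
  (forall x, c < x -> is_derive x (1 : R) F (f x)) ->
  (forall x, c < x -> {for x, continuous f}) ->
  (\int[leb]_(x in `[a, t[) (f x)%:E = (F t - F a)%:E)%E.
Proof.
move=> ca; rewrite le_eqVlt => /predU1P[<- _ _|at_ dF cf].
  by rewrite set_itvco0// integral_set0 subrr.
have cin : {within `[a, t], continuous f}.
  by apply: continuous_in_subspaceT => x; rewrite inE/= in_itv/= => /andP[ax _];
    apply: cf; exact: lt_le_trans ax.
rewrite integral_itv_bndo_bndc; last first.
  apply/measurable_EFinP; apply: (measurable_funS (measurable_itv `[a, t])).
    exact: subset_itv_co_cc.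
  exact: subspace_continuous_measurable_fun.
have cF x : c < x -> {for x, continuous F}.
  move=> cx; apply: differentiable_continuous; rewrite -derivable1_diffP.
  by have [] := dF _ cx.
rewrite (@continuous_FTC2 _ f F _ _ at_ cin)//.
  split=> [x /[!in_itv]/= /andP[ax _]||].
  - by have [] := dF _ (lt_trans ca ax).
  - by apply: cvg_at_right_filter; apply: cF.
  - by apply: cvg_at_left_filter; apply: cF; exact: lt_trans at_.
move=> x /[!in_itv]/= /andP[ax _]; rewrite derive1E.
by have [] := dF _ (lt_trans ca ax).
Qed.

Lemma ge0_integral_itv_split (f : R -> \bar R) a t b : a <= t -> t <= b ->
  measurable_fun `[a, b[ f -> (forall x, a <= x < b -> (0 <= f x)%E) ->
  (\int[leb]_(x in `[a, b[) f x =
   \int[leb]_(x in `[a, t[) f x + \int[leb]_(x in `[t, b[) f x)%E.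
Proof.
move=> at_ tb mf f0.
have E : `[a, b[%classic = `[a, t[ `|` `[t, b[.
  by apply: itv_bndbnd_setU; rewrite bnd_simp.
rewrite E ge0_integral_setU -?E//.
  apply/disj_setPS => x [/=]; rewrite !in_itv/= => /andP[_ xt] /andP[tx _].
  by have := lt_le_trans xt tx; rewrite ltxx.
Qed.

End Integrals.

(** * The two roots of the equation for the lower threshold *)

Section Roots.
Context {R : realType}.
Implicit Types (a b x z beta mu vbar : R).

(** This makes the constant [beta] of the reduced equation less than 1 whenever mu < vbar. In the
    induction on M = m + 1, the new factor (1 + 1/M)^2 is at most e^(2/M), and the exponent grows by
    at least 2/M. *)
Lemma sqr_le_expR m : (0 < m)%N ->
  m.+1%:R ^+ 2 <= expR (m.+1%:R - m.+1%:R^-1 : R).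
Proof.
elim: m => // -[_ _|m IH _].
  (* For M = 2, e^(3/2) is at least (1 + 3/20)^10, which is just above 4. *)
  rewrite (_ : 2 - 2^-1 = 10%:R * (3 / 20) :> R); last by field.
  rewrite expRM_natl; apply: (@le_trans _ _ ((1 + 3 / 20 : R) ^+ 10)); first by lra.
  by rewrite lerXn2r ?nnegrE ?expR_ge0 ?expR_ge1Dx//; lra.
have {}IH := IH isT; set M : R := m.+2%:R in IH *.
have M2 : 2 <= M by rewrite /M ler_nat.
have M0 : 0 < M by lra.
have -> : m.+3%:R = M + 1 :> R by rewrite /M natr1.
have -> : (M + 1) ^+ 2 = M ^+ 2 * (1 + M^-1) ^+ 2 by field; rewrite gt_eqF.
apply: (@le_trans _ _ (expR (M - M^-1) * expR (2%:R * M^-1))).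
  apply: ler_pM; rewrite ?sqr_ge0// expRM_natl lerXn2r ?nnegrE ?expR_ge0 ?expR_ge1Dx//.
  by rewrite addr_ge0// invr_ge0 ltW.
rewrite -expRD ler_expR.
have V0 : 0 < M^-1 by rewrite invr_gt0.
have V1 : 0 < (M + 1)^-1 by rewrite invr_gt0; lra.
have : (M + 1)^-1 <= 1 - M^-1.
  rewrite -subr_ge0 (_ : _ - _ = (M ^+ 2 - M - 1) / (M * (M + 1))); last first.
    by field; rewrite !gt_eqF//; lra.
  by apply: divr_ge0; [nra|apply: mulr_ge0; lra].
by move: (M + 1)^-1 (M^-1) => u v; lra.
Qed.

(** Writing x = vbar e^(k - z) with k = n - 1 - 1/(n-1) turns [vlow_eq] into phi z = beta. [phi]
    rises from 0 to 1 on [-1, 0] and falls on [0, +oo[, which yields one root on each side of 0. *)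
Let phi z : R := (1 + z) * expR (- z).

Let phi_decr a b : 0 <= a -> a < b -> phi b < phi a.
Proof.
move=> a0 ab; rewrite /phi (_ : - b = - a - (b - a)); last by ring.
rewrite expRD mulrA ![_ * expR (- a)]mulrC -mulrA ltr_pM2l ?expR_gt0//.
rewrite expRN ltr_pdivrMr ?expR_gt0//.
apply: (@le_lt_trans _ _ ((1 + a) * (1 + (b - a)))); first by nra.
rewrite ltr_pM2l; last by lra.
by apply: expR_gt1Dx; lra.
Qed.

Let phi_incr a b : -1 < a -> a < b -> b <= 0 -> phi a < phi b.
Proof.
move=> a1 ab b0; rewrite /phi (_ : - a = - b + (b - a)); last by ring.
rewrite expRD mulrA ![_ * expR (- b)]mulrC -mulrA ltr_pM2l ?expR_gt0//.
rewrite -[b - a]opprB expRN ltr_pdivrMr ?expR_gt0//.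
apply: (@le_lt_trans _ _ ((1 + b) * (1 + (a - b)))); first by nra.
rewrite ltr_pM2l; last by lra.
by apply: expR_gt1Dx; lra.
Qed.

Let continuous_phi : continuous phi.
Proof.
move=> z; apply: cvgM; first by apply: cvgD; [exact: cvg_cst|exact: cvg_id].
apply: (@cvg_comp _ _ _ -%R expR); first exact: opp_continuous.
exact: continuous_expR.
Qed.

Let phi_roots beta : 0 < beta < 1 ->
  exists z1 z2, [/\ z2 < 0, 0 < z1, phi z1 = beta
    & forall z, phi z = beta <-> z = z1 \/ z = z2].
Proof.
move=> /andP[b0 b1].
have phi0 : phi 0 = 1 by rewrite /phi oppr0 expR0 addr0 mulr1.
have phiN1 : phi (-1) = 0 by rewrite /phi subrr mul0r.
(* Since e^Z is at least 1 + Z^2 / 2 and beta Z = 4, phi Z <= beta reduces to 1 + Z <= beta + 2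
   Z. *)
pose Z := 4 / beta.
have Z0 : 0 < Z by rewrite divr_gt0.
have phiZ : phi Z <= beta.
  rewrite /phi expRN ler_pdivrMr ?expR_gt0//.
  apply: (@le_trans _ _ (beta * (1 + Z ^+ 2 / 2))); last first.
    by rewrite ler_pM2l// (le_trans _ (expR_ge1Dxn 1%N (ltW Z0))).
  have bZ : beta * Z = 4 by rewrite /Z mulrC divfK// gt_eqF.
  have Z4 : 4 <= Z by rewrite /Z ler_pdivlMr//; lra.
  rewrite (_ : beta * _ = beta + beta * Z * Z / 2); last by ring.
  by rewrite bZ; lra.
have [z1] : exists2 z1, z1 \in `[0, Z] & phi z1 = beta.
  apply: IVT; [exact: ltW|exact: continuous_subspaceT|].
  by rewrite phi0 ge_min phiZ orbT le_max ltW.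
rewrite in_itv/= => /andP[z10 _] phi1.
have [z2] : exists2 z2, z2 \in `[-1, 0] & phi z2 = beta.
  apply: IVT; [lra|exact: continuous_subspaceT|].
  by rewrite phi0 phiN1 ge_min (ltW b0) le_max (ltW b1) orbT.
rewrite in_itv/= => /andP[z21 z20] phi2.
have z1p : 0 < z1.
  by rewrite lt_neqAle z10 andbT; apply/eqP => h; move: phi1; rewrite -h phi0; lra.
have z2n : z2 < 0.
  by rewrite lt_neqAle z20 andbT; apply/eqP => h; move: phi2; rewrite h phi0; lra.
have z2g : -1 < z2.
  rewrite lt_neqAle z21 andbT; apply/eqP => h; move: phi2; rewrite -h phiN1; lra.
exists z1, z2; split => // z; split => [phiz|[] ->//].
have [zn|zp] := ltP z 0.
  have zg : -1 < z.
    rewrite ltNge; apply/negP => z1n; have : phi z <= 0.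
      by rewrite /phi mulr_le0_ge0 ?expR_ge0//; lra.
    by rewrite phiz; lra.
  right; have [h|h|//] := ltgtP z z2.
    by have := phi_incr zg h (ltW z2n); rewrite phiz phi2 ltxx.
  by have := phi_incr z2g h (ltW zn); rewrite phiz phi2 ltxx.
left; have [h|h|//] := ltgtP z z1.
  by have := phi_decr zp h; rewrite phiz phi1 ltxx.
by have := phi_decr (ltW z1p) h; rewrite phiz phi1 ltxx.
Qed.

(** The last clause is equivalent to vbar / (n-1) <= v0 for the v0 of the second case. It comes from
    the monotonicity of [phi]: vbar <= vl means z1 <= k, so phi k <= beta. *)
Lemma vlow_eq_roots m mu vbar : (0 < m)%N -> 0 < mu -> mu < vbar ->
  exists vl vh, [/\ 0 < vl, vl < vh,
    forall x, 0 < x -> (vlow_eq m.+2 mu vbar x <-> x = vl \/ x = vh)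
    & vbar <= vl ->
      (m.+1%:R - m.+1%:R^-1 + 1) * vbar <= m.+1%:R ^+ 2 * mu].
Proof.
move=> m0 mu0 mub; have b0 : 0 < vbar := lt_trans mu0 mub.
have nE : m.+2%:R - 1 = m.+1%:R :> R by rewrite -(natr1 m.+1) addrK.
set M : R := m.+1%:R; pose k := M - M^-1.
have M0 : 0 < M by rewrite ltr0n.
pose beta := M ^+ 2 * mu / (vbar * expR k).
have bk0 : 0 < vbar * expR k by rewrite mulr_gt0 ?expR_gt0.
have beta01 : 0 < beta < 1.
  apply/andP; split; first by rewrite divr_gt0// mulr_gt0// exprn_gt0.
  rewrite /beta ltr_pdivrMr// mul1r.
  apply: (@le_lt_trans _ _ (expR k * mu)).
    by rewrite ler_pM2r// sqr_le_expR.
  by rewrite mulrC ltr_pM2r ?expR_gt0.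
have [z1 [z2 [z2n z1p phi1 phiP]]] := phi_roots beta01.
have eqP x z : x = vbar * expR (k - z) -> vlow_eq m.+2 mu vbar x <-> phi z = beta.
  move=> ->; rewrite /vlow_eq nE -/M.
  have -> : m.+2%:R = M + 1 :> R by rewrite /M natr1.
  have -> : ln (vbar / (vbar * expR (k - z))) = z - k.
    by rewrite invfM mulrA divff ?gt_eqF// mul1r -expRN opprB expRK.
  have -> : (M + 1 - M^-1 + (z - k)) * (vbar * expR (k - z)) = phi z * (vbar * expR k).
    by rewrite /phi expRD /k; ring.
  rewrite /beta; split => [<-|->]; first by rewrite mulfK ?gt_eqF.
  by rewrite divfK ?gt_eqF.
have xE x : 0 < x -> x = vbar * expR (k - (k - ln (x / vbar))).
  move=> x0; rewrite opprB addrC subrK lnK ?posrE ?divr_gt0//.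
  by rewrite mulrC divfK ?gt_eqF.
(* x decreases in z, so the positive solution [z1] gives the smaller root. *)
exists (vbar * expR (k - z1)), (vbar * expR (k - z2)); split.
- by rewrite mulr_gt0 ?expR_gt0.
- by rewrite ltr_pM2l// ltr_expR; lra.
- move=> x x0; rewrite (eqP _ _ (xE x x0)) phiP.
  have e z : (k - ln (x / vbar) = z) <-> x = vbar * expR (k - z).
    split=> [<-|->]; first exact: xE.
    by rewrite [vbar * _]mulrC mulfK ?gt_eqF// expRK; ring.
  by rewrite !e.
- move=> bl.
  have z1k : z1 <= k.
    by move: bl; rewrite -{1}[vbar]mulr1 ler_pM2l// -expR0 ler_expR; lra.
  have : phi k <= phi z1.
    move: z1k; rewrite le_eqVlt => /predU1P[->//|z1k].
    by apply/ltW/phi_decr => //; exact: ltW.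
  rewrite phi1 /beta /phi expRN => h.
  have : (1 + k) / expR k * (vbar * expR k) <= M ^+ 2 * mu.
    by rewrite -ler_pdivlMr.
  by rewrite mulrCA mulfVK ?gt_eqF ?expR_gt0// -/k mulrC addrC.
Qed.

End Roots.

(** * Derivative rules in pointwise form *)

Section PointwiseDerivatives.
Context {R : realType}.
Implicit Types (f g : R -> R) (x a b : R).

Lemma is_derive_mul_fun f g x a b :
  is_derive x (1 : R) f a -> is_derive x (1 : R) g b ->
  is_derive x (1 : R) (fun z => f z * g z) (a * g x + f x * b).
Proof.
move=> df dg; have dd := is_deriveM df dg.
apply: (is_derive_eq dd).
by rewrite addrC /GRing.scale/= [g x * a]mulrC.
Qed.

Lemma is_derive_exp_fun f n x a : is_derive x (1 : R) f a ->
  is_derive x (1 : R) (fun z => f z ^+ n) (n%:R * f x ^+ n.-1 * a).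
Proof.
move=> df; have := is_deriveX n df; rewrite /GRing.scale/=.
rewrite (_ : f ^+ n = fun z => f z ^+ n)//; apply/funext => z.
by elim: n => // n IH; rewrite !exprS -IH.
Qed.

Lemma is_derive_continuous f x a : is_derive x (1 : R) f a -> {for x, continuous f}.
Proof.
move=> [df _]; apply: differentiable_continuous.
by rewrite -derivable1_diffP.
Qed.

End PointwiseDerivatives.

Lemma ln_le_subr1 {R : realType} (x : R) : 0 < x -> ln x <= x - 1.
Proof.
move=> x0; have := @le_ln1Dx R (x - 1).
by rewrite (_ : 1 + (x - 1) = x); [apply; lra|ring].
Qed.

(** * The formulas of the equilibrium cdfs *)

Section EquilibriumCDFs.
Context {R : realType}.
Variables (m : nat) (w b v0 : R).
Hypotheses (m0 : (0 < m)%N) (w0 : 0 < w) (wb : w <= b).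
Implicit Types (x y t r : R).

Local Notation M := (m.+1%:R : R).

(** Scale of the equal-revenue tail 1 - c/x of [F], set so that the tail starts from 1 - 1/M^2 at x
    = w. *)
Definition fscale : R := w / M ^+ 2.
Local Notation c := fscale.

(** The constant for which [qslope] vanishes at [w]; it equals M (1 - c/w). *)
Definition qmin : R := M - M^-1.

Definition qlog x : R := qmin + ln (x / w).

Definition qratio x : R := x / (x - c).

(** Normalises [qbody] to 1 at [b]; it is also 1/n of the multiplier of the mean. *)
Definition qcoef : R := (1 - c / b) ^+ m.+1 / qlog b.

Definition qbody x : R := qcoef * qratio x ^+ m.+1 * qlog x.

(* [x] times the derivative of [qbody] at [x]. *)
Definition qslope x : R :=
  qcoef * qratio x ^+ m.+1 * (1 - M * (qratio x - 1) * qlog x).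

Let M2 : 2 <= M. Proof. by rewrite ler_nat ltnS. Qed.
Let Mp : 0 < M. Proof. by rewrite ltr0n. Qed.
Let bp : 0 < b. Proof. exact: lt_le_trans w0 wb. Qed.

Lemma fscale_gt0 : 0 < c.
Proof. by rewrite divr_gt0// exprn_gt0. Qed.

Lemma fscale_lt : c < w.
Proof.
rewrite /fscale ltr_pdivrMr ?exprn_gt0// ltr_pMr//.
by rewrite exprn_egt1//; have := M2; lra.
Qed.

Lemma qmin_gt0 : 0 < qmin.
Proof.
rewrite /qmin subr_gt0; have M1 : 1 < M by have := M2; lra.
by apply: (@lt_trans _ _ 1) => //; rewrite invf_lt1.
Qed.

Lemma qlog_ge x : w <= x -> qmin <= qlog x.
Proof.
by move=> wx; rewrite /qlog lerDl ln_ge0// ler_pdivlMr// mul1r.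
Qed.

Lemma qlog_gt0 x : w <= x -> 0 < qlog x.
Proof. by move=> /qlog_ge; apply: lt_le_trans; exact: qmin_gt0. Qed.

Lemma fbody_gt0 x : w <= x -> 0 < 1 - c / x.
Proof.
move=> wx; have x0 := lt_le_trans w0 wx.
by rewrite subr_gt0 ltr_pdivrMr// mul1r (lt_le_trans fscale_lt).
Qed.

Lemma qratioE x : c < x -> qratio x = (1 - c / x)^-1.
Proof.
move=> cx; have x0 := lt_trans fscale_gt0 cx.
rewrite /qratio; field; rewrite subr_eq0 !gt_eqF//.
Qed.

Lemma qratio_gt0 x : c < x -> 0 < qratio x.
Proof. by move=> cx; rewrite divr_gt0 ?subr_gt0// (lt_trans fscale_gt0). Qed.

Lemma qcoef_gt0 : 0 < qcoef.
Proof. by rewrite divr_gt0 ?qlog_gt0// exprn_gt0// fbody_gt0. Qed.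

Lemma qbody_b : qbody b = 1.
Proof.
rewrite /qbody qratioE ?(lt_le_trans fscale_lt)// exprVn /qcoef.
rewrite mulrAC divfK ?gt_eqF ?qlog_gt0// divff// expf_neq0//.
by rewrite gt_eqF// fbody_gt0.
Qed.

Lemma qbody_ge0 x : w <= x -> 0 <= qbody x.
Proof.
move=> wx; rewrite /qbody mulr_ge0 ?(ltW (qlog_gt0 _))// mulr_ge0 ?(ltW qcoef_gt0)//.
by rewrite exprn_ge0// ltW// qratio_gt0// (lt_le_trans fscale_lt).
Qed.

(** The hypothesis of [lagrangian_min] at a = 1 - c/x and y = [qlog x], tight at x = w. It follows
    from ln (x/w) >= 1 - w/x. *)
Lemma qlog_lower x : w <= x -> M * (1 - c / x) <= qlog x.
Proof.
move=> wx; have x0 := lt_le_trans w0 wx; have wx0 : 0 < w / x by rewrite divr_gt0.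
have wx1 : w / x <= 1 by rewrite ler_pdivrMr// mul1r.
have h : 1 - w / x <= ln (x / w).
  rewrite -[x / w]invf_div lnV ?posrE// lerNr.
  by have := ln_le_subr1 wx0; lra.
rewrite /qlog /qmin (_ : M * _ = M - M^-1 * (w / x)); last first.
  by rewrite /fscale; field; rewrite !gt_eqF.
have V1 : M^-1 <= 1 by rewrite invf_le1//; have := M2; lra.
have : 0 <= (1 - M^-1) * (1 - w / x) by rewrite mulr_ge0// subr_ge0.
by move: (M^-1) (w / x) (ln _) h => V z l h; lra.
Qed.

(** Needed for [qbody] to be monotone and for the slope to serve as the nonnegative [s]. The bound
    ln z <= z - 1 at z = x/w suffices: it gives [qlog x] <= M z - 1/M, and M^-1 w times this bound
    is exactly x - c. *)
Lemma qslope_ge0 x : w <= x -> 0 <= qslope x.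
Proof.
move=> wx; have x0 := lt_le_trans w0 wx; have cx := lt_le_trans fscale_lt wx.
rewrite /qslope mulr_ge0//.
  by rewrite mulr_ge0 ?(ltW qcoef_gt0)// exprn_ge0// ltW// qratio_gt0.
have -> : M * (qratio x - 1) = M^-1 * w / (x - c).
  have -> : M^-1 * w = M * c by rewrite /fscale; field; rewrite gt_eqF.
  by rewrite /qratio; field; rewrite subr_eq0 gt_eqF.
rewrite subr_ge0 mulrAC ler_pdivrMr ?subr_gt0// mul1r.
have h := ln_le_subr1 (divr_gt0 x0 w0).
have xw : 1 <= x / w by rewrite ler_pdivlMr// mul1r.
have yx : qlog x <= M * (x / w) - M^-1.
  rewrite /qlog /qmin; have : 0 <= (M - 1) * (x / w - 1).
    by rewrite mulr_ge0 ?subr_ge0//; have := M2; lra.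
  by move: (M^-1) (x / w) (ln _) h => V z l h; lra.
apply: (@le_trans _ _ (M^-1 * w * (M * (x / w) - M^-1))).
  by rewrite ler_pM2l// mulr_gt0 ?invr_gt0.
by rewrite /fscale le_eqVlt; apply/orP; left; apply/eqP; field; rewrite !gt_eqF.
Qed.

Lemma is_derive_qratio x : c < x ->
  is_derive x (1 : R) qratio (- (qratio x * (qratio x - 1) / x)).
Proof.
move=> cx; have x0 := lt_trans fscale_gt0 cx.
have xc : x - c != 0 by rewrite subr_eq0 gt_eqF.
have d1 : is_derive x (1 : R) (fun z : R => z - c) 1.
  by apply: is_derive_eq; rewrite subr0.
have d2 := @is_deriveV R (fun z => z - c) x 1 1 xc d1.
have dd := is_derive_mul_fun (is_derive_id x (1 : R)) d2.
apply: (is_derive_eq dd).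
by rewrite /GRing.scale/= /qratio; field; rewrite xc gt_eqF.
Qed.

Lemma is_derive_qlog x : 0 < x -> is_derive x (1 : R) qlog x^-1.
Proof.
move=> x0.
have d1 : is_derive x (1 : R) (fun z : R => z * w^-1) w^-1.
  have dd := is_derive_mul_fun (is_derive_id x (1 : R))
    (is_derive_cst w^-1 x (1 : R)).
apply: (is_derive_eq dd).
  by rewrite mul1r mulr0 addr0.
have xw : 0 < x * w^-1 by rewrite divr_gt0.
have d2 := @is_derive1_comp R (@ln R) (fun z => z * w^-1) x _ _ (is_derive1_ln xw) d1.
have dd := is_deriveD (is_derive_cst qmin x (1 : R)) d2.
apply: (is_derive_eq dd).
by rewrite add0r invfM invrK mulfK// gt_eqF.
Qed.

Lemma is_derive_qbody x : c < x -> is_derive x (1 : R) qbody (qslope x / x).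
Proof.
move=> cx; have x0 := lt_trans fscale_gt0 cx.
have d1 := is_derive_exp_fun m.+1 (is_derive_qratio cx).
have d2 := is_derive_mul_fun (is_derive_cst qcoef x (1 : R)) d1.
have dd := is_derive_mul_fun d2 (is_derive_qlog x0).
apply: (is_derive_eq dd).
by rewrite /qslope /= exprS; field; rewrite gt_eqF.
Qed.

Lemma is_derive_mul_qbody x : c < x ->
  is_derive x (1 : R) (fun z => z * qbody z) (qbody x + qslope x).
Proof.
move=> cx; have x0 := lt_trans fscale_gt0 cx.
have dd := is_derive_mul_fun (is_derive_id x (1 : R)) (is_derive_qbody cx).
apply: (is_derive_eq dd).
by rewrite mul1r [x * _]mulrC divfK// gt_eqF.
Qed.

Lemma continuous_qslope x : c < x -> {for x, continuous qslope}.
Proof.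
move=> cx; have x0 := lt_trans fscale_gt0 cx.
have cr := is_derive_continuous (is_derive_qratio cx).
have cl := is_derive_continuous (is_derive_qlog x0).
have ce := is_derive_continuous (is_derive_exp_fun m.+1 (is_derive_qratio cx)).
apply: cvgM; first by apply: cvgM => //; exact: cvg_cst.
apply: cvgB; first exact: cvg_cst.
apply: cvgM => //; apply: cvgM; first exact: cvg_cst.
by apply: cvgB => //; exact: cvg_cst.
Qed.

Lemma qbody_nondecreasing x y : w <= x -> x <= y -> qbody x <= qbody y.
Proof.
move=> wx xy.
have d z : z \in `]x, y[ -> is_derive z (1 : R) qbody (qslope z / z).
  rewrite in_itv/= => /andP[xz _]; apply: is_derive_qbody.
  by rewrite (lt_trans fscale_lt)// (le_lt_trans wx).
apply: (@ger0_derive1_le_cc _ qbody x y); rewrite ?in_itv/= ?lexx ?xy//.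
- by move=> z /d[].
- move=> z zxy; rewrite derive1E; have [_ ->] := d z zxy.
  move: zxy; rewrite in_itv/= => /andP[xz _].
  have wz := le_trans wx (ltW xz).
  by rewrite divr_ge0 ?qslope_ge0// (le_trans (ltW w0)).
apply: derivable_within_continuous => z; rewrite in_itv/= => /andP[xz _].
have cz : c < z by rewrite (lt_le_trans fscale_lt)// (le_trans wx).
by have [] := is_derive_qbody cz.
Qed.

End EquilibriumCDFs.

(** * The equilibrium laws *)

Section EquilibriumLaws.
Context {R : realType}.
Variables (m : nat) (w b v0 : R).
Hypotheses (m0 : (0 < m)%N) (w0 : 0 < w) (wb : w <= b).
Implicit Types (x y t r : R).
Local Notation M := (m.+1%:R : R).
Local Notation c := (fscale m w).

Let M2 : 2 <= M. Proof. by rewrite ler_nat ltnS. Qed.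
Let Mp : 0 < M. Proof. by rewrite ltr0n. Qed.
Let bp : 0 < b. Proof. exact: lt_le_trans w0 wb. Qed.
Let cp : 0 < c. Proof. exact: fscale_gt0. Qed.
Let cw : c < w. Proof. exact: fscale_lt. Qed.

(** Clamping the argument to [w, b] produces both flat pieces from one continuous function, so that
    [Qcdf] jumps only at 0. *)
Definition Qclamped x : R := qbody m w b (Num.max w (Num.min x b)).

Definition Qcdf x : R := if x < 0 then 0 else Qclamped x.

Definition Fcdf x : R :=
  if x < v0 then 0 else if x < b then 1 - c / Num.max w x else 1.

Lemma Qclamped_continuous : continuous Qclamped.
Proof.
move=> x; apply: (@cvg_comp _ _ _ (fun y => Num.max w (Num.min y b)) (qbody m w b)).
  apply: (@continuous_max R R (cst w) (fun y => Num.min y b)); first exact: cvg_cst.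
  apply: (@continuous_min R R id (cst b)); first exact: cvg_id.
  exact: cvg_cst.
have cx : c < Num.max w (Num.min x b) by rewrite (lt_le_trans cw)// le_max lexx.
exact: (is_derive_continuous (is_derive_qbody b w0 cx)).
Qed.

Lemma Qcdf_low x : 0 <= x -> x <= w -> Qcdf x = qbody m w b w.
Proof.
move=> x0 xw; rewrite /Qcdf ltNge x0 /= /Qclamped.
by rewrite max_l// ge_min xw.
Qed.

Lemma Qcdf_mid x : w <= x -> x <= b -> Qcdf x = qbody m w b x.
Proof.
move=> wx xb; rewrite /Qcdf ltNge (le_trans (ltW w0) wx) /= /Qclamped.
by rewrite (min_l xb) (max_r wx).
Qed.

Lemma Qcdf_ge x : b <= x -> Qcdf x = 1.
Proof.
move=> bx; rewrite /Qcdf ltNge (le_trans (ltW bp) bx) /= /Qclamped.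
by rewrite (min_r bx) (max_r wb) qbody_b.
Qed.

Lemma Qcdf_law_exists : exists Q : law R, forall x, cdf_law Q x = (Qcdf x)%:E.
Proof.
apply: (@law_of_cdf _ _ b).
- move=> x y xy; rewrite /Qcdf; have [x0|x0] := ltP x 0.
    by case: ifP => // _; rewrite qbody_ge0// le_max lexx.
  rewrite ltNge (le_trans x0 xy) /=; apply: qbody_nondecreasing => //.
    by rewrite le_max lexx.
  by rewrite ge_max le_max lexx /= le_max le_min !ge_min xy lexx !orbT.
- move=> x; apply: cvg_at_right_if => _; first exact: cvg_cst.
  by apply: cvg_at_right_filter; exact: Qclamped_continuous.
- by move=> x x0; rewrite /Qcdf x0.
- exact: Qcdf_ge.
Qed.

Hypotheses (v0w : v0 < w) (wv0 : w / M <= v0).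

Let v0p : 0 < v0. Proof. by apply: lt_le_trans wv0; rewrite divr_gt0. Qed.

Lemma Fcdf_neg x : x < v0 -> Fcdf x = 0.
Proof. by rewrite /Fcdf => ->. Qed.

Lemma Fcdf_low x : v0 <= x -> x < w -> Fcdf x = 1 - c / w.
Proof.
move=> vx xw; rewrite /Fcdf ltNge vx /= (lt_le_trans xw wb).
by rewrite max_l// ltW.
Qed.

Lemma Fcdf_mid x : w <= x -> x < b -> Fcdf x = 1 - c / x.
Proof.
by move=> wx xb; rewrite /Fcdf ltNge (le_trans (ltW v0w) wx) /= xb max_r.
Qed.

Lemma Fcdf_ge x : b <= x -> Fcdf x = 1.
Proof.
move=> bx; have wx := le_trans wb bx.
by rewrite /Fcdf ltNge (le_trans (ltW v0w) wx) /= ltNge bx.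
Qed.

Lemma Fcdf_law_exists : exists F : law R, forall x, cdf_law F x = (Fcdf x)%:E.
Proof.
have maxp x : 0 < Num.max w x by rewrite lt_max w0.
have body01 x : 0 <= 1 - c / Num.max w x <= 1.
  rewrite ltW ?fbody_gt0 ?le_max ?lexx//= gerBl.
  by rewrite divr_ge0 ?(ltW cp) ?(ltW (maxp _)).
apply: (@law_of_cdf _ _ b).
- move=> x y xy; rewrite /Fcdf; have [x0|x0] := ltP x v0.
    case: ifP => // _; case: ifP => // _; by case/andP: (body01 y).
  rewrite (ltNge y v0) (le_trans x0 xy) /=; have [xb|bx] := ltP x b.
    case: ifP => // yb; last by case/andP: (body01 x).
    rewrite lerD2l lerN2 ler_pM2l// lef_pV2 ?posrE ?maxp//.
    by rewrite ge_max le_max lexx /= le_max xy orbT.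
  by rewrite (ltNge y b) (le_trans bx xy).
- move=> x; apply: cvg_at_right_if => _; first exact: cvg_cst.
  apply: cvg_at_right_if => _; last exact: cvg_cst.
  apply: cvg_at_right_filter; apply: cvgB; first exact: cvg_cst.
  apply: cvgM; first exact: cvg_cst.
  apply: cvgV; first by rewrite gt_eqF// maxp.
  by apply: (@continuous_max R R (cst w) id); [exact: cvg_cst|exact: cvg_id].
- by move=> x x0; apply: Fcdf_neg; exact: lt_trans v0p.
- exact: Fcdf_ge.
Qed.

End EquilibriumLaws.

(** * Optimality of both sides *)

Section EquilibriumGame.
Context {R : realType}.
Variables (m : nat) (w b v0 : R) (Q F : law R).
Hypotheses (m0 : (0 < m)%N) (w0 : 0 < w) (wb : w <= b).
Hypotheses (v0w : v0 < w) (wv0 : w / m.+1%:R <= v0) (v0E : w < b -> v0 = w / m.+1%:R).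
Hypotheses (QE : forall x, cdf_law Q x = (Qcdf m w b x)%:E).
Hypotheses (FE : forall x, cdf_law F x = (Fcdf m w b v0 x)%:E).
Implicit Types (x y t r : R) (psi : R -> R).
Local Notation leb := (@lebesgue_measure R).
Local Notation M := (m.+1%:R : R).
Local Notation c := (fscale m w).

Let M2 : 2 <= M. Proof. by rewrite ler_nat ltnS. Qed.
Let Mp : 0 < M. Proof. by rewrite ltr0n. Qed.
Let bp : 0 < b. Proof. exact: lt_le_trans w0 wb. Qed.
Let cp : 0 < c. Proof. exact: fscale_gt0. Qed.
Let cw : c < w. Proof. exact: fscale_lt. Qed.
Let v0p : 0 < v0. Proof. by apply: lt_le_trans wv0; rewrite divr_gt0. Qed.

Let cdfrQ x : cdfr Q x = Qcdf m w b x. Proof. by rewrite /cdfr QE. Qed.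
Let cdfrF x : cdfr F x = Fcdf m w b v0 x. Proof. by rewrite /cdfr FE. Qed.

Lemma supported_Q : supported b Q.
Proof.
apply: supported_cdfr; [exact: ltW|by rewrite cdfrQ Qcdf_ge|].
by move=> x x0; rewrite cdfrQ /Qcdf x0.
Qed.

Lemma supported_F : supported b F.
Proof.
apply: supported_cdfr; [exact: ltW|by rewrite cdfrF Fcdf_ge|].
by move=> x x0; rewrite cdfrF Fcdf_neg// (lt_trans x0).
Qed.

Let Q_left t : 0 < t -> Q `]-oo, t[%classic = (cdfr Q t)%:E.
Proof.
move=> t0; apply: cdfr_left; rewrite cdfrQ /Qcdf ltNge (ltW t0) /=.
have h : Qclamped m w b x @[x --> t^'-] --> Qclamped m w b t.
  by apply: cvg_at_left_filter; exact: Qclamped_continuous.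
apply: cvg_trans h; apply: near_eq_cvg; near=> y.
by rewrite cdfrQ /Qcdf ltNge (ltW _)//; near: y; exact: nbhs_left_gt.
Unshelve. all: by end_near. Qed.

Definition slope : R -> R := qslope m w b \_ `[w, b[.

Lemma slope_ge0 x : 0 <= slope x.
Proof.
rewrite /slope patchE; case: ifPn => //; rewrite inE/= in_itv/= => /andP[wx _].
exact: qslope_ge0.
Qed.

Lemma measurable_slope : measurable_fun setT slope.
Proof.
have [h _] := measurable_restrictT (qslope m w b) (measurable_itv `[w, b[).
apply: h; apply: subspace_continuous_measurable_fun => //.
apply: continuous_in_subspaceT => x; rewrite inE/= in_itv/= => /andP[wx _].
by apply: continuous_qslope => //; exact: lt_le_trans wx.
Qed.

Let slope_low x : x < w -> slope x = 0.
Proof. by move=> xw; rewrite /slope patchE memNset//= in_itv/= leNgt xw. Qed.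

Let slope_mid x : w <= x < b -> slope x = qslope m w b x.
Proof. by move=> xw; rewrite /slope patchE mem_set//= in_itv. Qed.

Let integral_Q_low t : 0 <= t -> t <= w ->
  (\int[leb]_(x in `[0%R, t[) (cdfr Q x + slope x)%:E = (t * qbody m w b w)%:E)%E.
Proof.
move=> t0 tw; transitivity (\int[leb]_(x in `[0%R, t[) (qbody m w b w)%:E)%E.
  apply: eq_integral => x; rewrite inE/= in_itv/= => /andP[x0 xt].
  have xw := lt_le_trans xt tw.
  by rewrite slope_low// addr0 cdfrQ Qcdf_low// ltW.
by rewrite integral_cst_itv// subr0 mulrC.
Qed.

Lemma integral_Q t : 0 < t <= b ->
  (\int[leb]_(x in `[0%R, t[) (cdfr Q x + slope x)%:E = (t * cdfr Q t)%:E)%E.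
Proof.
move=> /andP[t0 tb]; have [tw|wt] := leP t w.
  by rewrite (integral_Q_low (ltW t0) tw) cdfrQ Qcdf_low// ltW.
rewrite (@ge0_integral_itv_split _ _ 0 w)//; last 4 first.
- exact: ltW.
- exact: ltW.
- apply/measurable_EFinP/measurable_funD; first exact: measurable_cdfr.
  by apply: measurable_funTS; exact: measurable_slope.
- by move=> x _; rewrite lee_fin addr_ge0 ?cdfr_ge0 ?slope_ge0.
rewrite (integral_Q_low (ltW w0) (lexx w)).
transitivity ((w * qbody m w b w)%:E + \int[leb]_(x in `[w, t[)
    (qbody m w b x + qslope m w b x)%:E)%E.
  congr (_ + _)%E; apply: eq_integral => x; rewrite inE/= in_itv/= => /andP[wx xt].
  have xb := lt_le_trans xt tb.
  by rewrite slope_mid ?wx// cdfrQ Qcdf_mid// ltW.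
have dQ x : c < x -> is_derive x (1 : R) (fun z => z * qbody m w b z)
    (qbody m w b x + qslope m w b x) by exact: is_derive_mul_qbody.
have cQ x : c < x -> {for x, continuous (fun z => qbody m w b z + qslope m w b z)}.
  move=> cx; apply: cvgD; last exact: continuous_qslope.
  exact: (is_derive_continuous (is_derive_qbody b w0 cx)).
rewrite (integral_derive cw (ltW wt) dQ cQ) -EFinD subrKC cdfrQ Qcdf_mid//.
exact: ltW.
Qed.

Lemma RevQ_QE F' : supported b F' -> RevQ m.+2 F' Q =
  (\int[leb]_(t in `[0%R, b[) (slope t * (1 - cdfr F' t ^+ m.+2)
     + cdfr Q t * second_tail m.+2 (cdfr F' t))%:E)%E.
Proof.
apply: RevQE => //.
- exact: supported_Q.
- exact: measurable_slope.
- exact: slope_ge0.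
- by move=> t /andP[t0 _]; exact: Q_left.
- exact: integral_Q.
Qed.

Section Profiles.
Variable psi : R -> R.
Hypotheses (psi0 : forall f, 0 <= f <= 1 -> 0 <= psi f).
Hypothesis mpsi : measurable_fun setT (psi \o cdfr F).

(** Used with 1 - f for the mean and with [second_tail] for the revenue; in both cases the integral
    is cut at the plateaus of [F]. *)
Let profile r : \bar R := (\int[leb]_(t in `[r, b[) (psi (cdfr F t))%:E)%E.

Let split_profile r t : r <= t -> t <= b ->
  (profile r = \int[leb]_(x in `[r, t[) (psi (cdfr F x))%:E + profile t)%E.
Proof.
move=> rt tb; apply: ge0_integral_itv_split => //.
  by apply/measurable_EFinP; exact: measurable_funTS mpsi.
by move=> x _; rewrite lee_fin psi0// cdfr01.
Qed.

Lemma profile_mid r : w <= r ->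
  profile r = (\int[leb]_(t in `[r, b[) (psi (1 - c / t))%:E)%E.
Proof.
move=> wr; apply: eq_integral => t; rewrite inE/= in_itv/= => /andP[rt tb].
by rewrite cdfrF Fcdf_mid// (le_trans wr).
Qed.

Lemma profile_low r : v0 <= r -> r <= w ->
  profile r = ((psi (1 - c / w) * (w - r))%:E + profile w)%E.
Proof.
move=> vr rw; rewrite (split_profile rw wb); congr (_ + _)%E.
rewrite -(integral_cst_itv true true)//; apply: eq_integral => t.
rewrite inE/= in_itv/= => /andP[rt tw].
by rewrite cdfrF Fcdf_low// (le_trans vr).
Qed.

Lemma profile_0 r : r <= v0 ->
  profile r = ((psi 0 * (v0 - r))%:E + profile v0)%E.
Proof.
move=> rv; rewrite (split_profile rv); last exact: le_trans (ltW v0w) wb.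
congr (_ + _)%E; rewrite -(integral_cst_itv true true)//; apply: eq_integral => t.
by rewrite inE/= in_itv/= => /andP[rt tv]; rewrite cdfrF Fcdf_neg.
Qed.

Lemma profile_all :
  profile 0 = ((psi 0 * v0)%:E + ((psi (1 - c / w) * (w - v0))%:E +
    \int[leb]_(t in `[w, b[) (psi (1 - c / t))%:E))%E.
Proof.
rewrite profile_0 ?(ltW v0p)// subr0 (profile_low (lexx _) (ltW v0w)).
by rewrite profile_mid.
Qed.

End Profiles.

Lemma mean_F : 'E_F[idTR]%E = (v0 + c / w * (w - v0) + c * (ln b - ln w))%:E.
Proof.
rewrite (mean_cdfr (ltW bp) supported_F).
have p0 f : 0 <= f <= 1 -> 0 <= 1 - f :> R by move=> /andP[_]; rewrite subr_ge0.
have mp : measurable_fun setT ((fun f => 1 - f) \o cdfr F).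
  by apply: measurable_funB => //; exact: measurable_cdfr.
apply: etrans (profile_all p0 mp) _.
transitivity (((1 - 0) * v0)%:E + ((1 - (1 - c / w)) * (w - v0))%:E +
   \int[leb]_(t in `[w, b[) (c * t^-1)%:E)%E.
  rewrite addeA; congr (_ + _)%E; apply: eq_integral => t _.
  by rewrite subKr.
have dln x : 0 < x -> is_derive x (1 : R) (fun z => c * ln z) (c * x^-1).
  move=> x0; have dd := is_derive_mul_fun (is_derive_cst c x (1 : R)) (is_derive1_ln x0).
  by apply: (is_derive_eq dd); rewrite mul0r add0r.
have cln x : 0 < x -> {for x, continuous (fun z : R => c * z^-1)}.
  move=> x0; apply: cvgM; first exact: cvg_cst.
  by apply: cvgV; [rewrite gt_eqF|exact: cvg_id].
by rewrite (integral_derive w0 wb dln cln) -!EFinD; congr EFin; ring.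
Qed.

Let G (f : R) := second_tail m.+2 f.

Let G_ge0 f : 0 <= f <= 1 -> 0 <= G f. Proof. exact: second_tail_ge0. Qed.

Let mG : measurable_fun setT (G \o cdfr F).
Proof.
by apply: measurable_funD; [apply: measurable_funB => //|];
  apply: measurable_funM => //; apply: measurable_funX; exact: measurable_cdfr.
Qed.

(** For F = 1 - c/z one has z F' = 1 - F, which makes z (1 - F^n) a primitive of G(F). Hence the
    revenue is the same for all reserves in [w, b[. *)
Let integral_tail_mid r : w <= r -> r <= b ->
  (\int[leb]_(t in `[r, b[) (G (1 - c / t))%:E =
   (b * (1 - (1 - c / b) ^+ m.+2) - r * (1 - (1 - c / r) ^+ m.+2))%:E)%E.
Proof.
move=> wr rb; have cr := lt_le_trans cw wr.
have d1 x : c < x -> is_derive x (1 : R) (fun z => 1 - c * z^-1) (c / x ^+ 2).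
  move=> cx; have x0 : x != 0 by rewrite gt_eqF// (lt_trans cp).
  have dV := @is_deriveV R id x 1 1 x0 (is_derive_id x (1 : R)).
  have dM := is_derive_mul_fun (is_derive_cst c x (1 : R)) dV.
  have dB := is_deriveB (is_derive_cst (1 : R) x (1 : R)) dM.
  by apply: (is_derive_eq dB); rewrite /GRing.scale/=; field.
have d2 x : c < x -> is_derive x (1 : R) (fun z => z * (1 - (1 - c * z^-1) ^+ m.+2))
    (G (1 - c / x)).
  move=> cx; have x0 : x != 0 by rewrite gt_eqF// (lt_trans cp).
  have dX := is_derive_exp_fun m.+2 (d1 x cx).
  have dB := is_deriveB (is_derive_cst (1 : R) x (1 : R)) dX.
  have dM := is_derive_mul_fun (is_derive_id x (1 : R)) dB.
  apply: (is_derive_eq dM); rewrite !fctE /G /second_tail /= -(natr1 m.+1).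
  have -> : c / x ^+ 2 = (1 - (1 - c / x)) / x by field.
  move: (1 - c / x) => f; rewrite (exprS f m.+1).
  by move: (f ^+ m.+1) => fm; field.
have c2 x : c < x -> {for x, continuous (fun z : R => G (1 - c * z^-1))}.
  move=> cx; have cX k := is_derive_continuous (is_derive_exp_fun k (d1 x cx)).
  apply: cvgD; last by apply: cvgM; [exact: cvg_cst|exact: cX].
  by apply: cvgB; [exact: cvg_cst|apply: cvgM; [exact: cvg_cst|exact: cX]].
exact: (integral_derive cr rb d2 c2).
Qed.

Let Rev_F r : 0 <= r -> r <= b -> Rev m.+2 F r =
  ((r * (1 - Fcdf m w b v0 r ^+ m.+2))%:E + \int[leb]_(t in `[r, b[) (G (cdfr F t))%:E)%E.
Proof.
move=> r0 rb; rewrite RevE// cdfrF; congr (_ + _)%E.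
rewrite (@integral_itv_bounded _ b) ?ltW//; last first.
  move=> t bt; rewrite cdfrF Fcdf_ge// /second_tail !expr1n !mulr1.
  by rewrite -(natr1 m.+1) (_ : 1 - (M + 1) + M = 0) ?mulr0//; ring.
rewrite integral_mkcond [RHS]integral_mkcond; apply: eq_integral => t _.
rewrite !patchE !mem_setE !in_itv/= indicE mem_setE in_itv/= andbT.
have [rt|tr] := leP r t; first by rewrite (le_trans r0 rt) /= mul1r.
by rewrite mul0r; case: ifP.
Qed.

(** Limit of the revenue as the reserve increases to [b], hence the revenue level on [w, b[. *)
Let peak : R := b * (1 - (1 - c / b) ^+ m.+2).

Let hold : R := 1 - c / w.

(** The revenue at reserve 0, cut at [v0] and [w]; it is the value of the game. *)
Let value : R := v0 * 1 + (w - v0) * G hold + (peak - w * (1 - hold ^+ m.+2)).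

Let holdE : hold = 1 - (M ^+ 2)^-1.
Proof. by rewrite /hold /fscale mulrAC divff ?mul1r// gt_eqF. Qed.

(** The rate at which the revenue grows with a reserve in [v0, w[; the product makes its sign
    visible. *)
Let hold_slope : 1 - hold ^+ m.+2 - G hold = m.+2%:R * hold ^+ m.+1 * (1 - hold).
Proof. by rewrite /G /second_tail /= -(natr1 m.+1) exprS; ring. Qed.

(* At [v0 = w / M] selling surely at [v0] and selling at [w] yield the same. *)
Let indifference : w / M + (w - w / M) * G hold = w * (1 - hold ^+ m.+2).
Proof.
rewrite /G /second_tail /= -(natr1 m.+1) (exprS hold m.+1).
by move: (hold ^+ m.+1) => p; rewrite holdE; field; rewrite gt_eqF.
Qed.

Let hold_ge0 : 0 <= hold. Proof. by rewrite ltW// fbody_gt0. Qed.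

Let hold_le1 : hold <= 1.
Proof. by rewrite gerBl divr_ge0 ?(ltW cp)// ltW. Qed.

Let G_hold_le : G hold <= 1 - hold ^+ m.+2.
Proof.
rewrite -subr_ge0 hold_slope mulr_ge0 ?subr_ge0//.
by rewrite mulr_ge0// exprn_ge0.
Qed.

Let G_hold_le1 : G hold <= 1.
Proof. by apply: le_trans G_hold_le _; rewrite gerBl exprn_ge0. Qed.

Let peak_le : peak <= value.
Proof.
rewrite /value -indifference -subr_ge0.
rewrite (_ : _ - _ = (v0 - w / M) * (1 - G hold)); last by ring.
by rewrite mulr_ge0// subr_ge0.
Qed.

Let Rev_F_mid r : w <= r -> r < b -> Rev m.+2 F r = peak%:E.
Proof.
move=> wr rb; rewrite Rev_F ?(le_trans (ltW w0) wr) ?ltW//.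
rewrite (profile_mid _ wr) integral_tail_mid ?(ltW rb)// -EFinD Fcdf_mid//.
by rewrite /peak subrKC.
Qed.

Let Rev_F_low r : v0 <= r -> r < w ->
  Rev m.+2 F r = (r * (1 - hold ^+ m.+2) + (w - r) * G hold + (peak - w * (1 - hold ^+ m.+2)))%:E.
Proof.
move=> vr rw; have r0 := le_trans (ltW v0p) vr.
rewrite Rev_F//; last exact: le_trans (ltW rw) wb.
rewrite (profile_low G_ge0 mG vr (ltW rw)) (profile_mid _ (lexx w)).
rewrite integral_tail_mid// -!EFinD (Fcdf_low _ _ vr)//.
by congr EFin; rewrite /peak /hold; ring.
Qed.

Let Rev_F_0 r : 0 <= r -> r < v0 -> Rev m.+2 F r = value%:E.
Proof.
move=> r0 rv; rewrite Rev_F//; last exact: le_trans (ltW rv) (le_trans (ltW v0w) wb).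
rewrite (profile_0 G_ge0 mG (ltW rv)) (profile_low G_ge0 mG (lexx _) (ltW v0w)).
rewrite (profile_mid _ (lexx w)) integral_tail_mid// -!EFinD Fcdf_neg//.
congr EFin; rewrite /value /peak /hold {1}/G /second_tail !expr0n /=.
by ring.
Qed.

Lemma Rev_F_le r : 0 <= r -> r <= b -> (Rev m.+2 F r <= value%:E)%E.
Proof.
move=> r0 rb; have [rv|vr] := ltP r v0; first by rewrite Rev_F_0.
have [rw|wr] := ltP r w.
  rewrite Rev_F_low// lee_fin; apply: le_trans peak_le.
  rewrite -subr_ge0.
  rewrite (_ : _ - _ = (w - r) * (1 - hold ^+ m.+2 - G hold)); last by ring.
  by rewrite mulr_ge0 ?subr_ge0// ltW.
move: rb; rewrite le_eqVlt => /predU1P[->|rb]; last by rewrite Rev_F_mid// lee_fin.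
(* At r = b no value exceeds the reserve, so the revenue is 0 rather than [peak]. *)
rewrite (Rev_F (ltW bp) (lexx b)) Fcdf_ge// set_itvco0// integral_set0 expr1n subrr mulr0 adde0.
rewrite lee_fin; apply: le_trans peak_le; apply: mulr_ge0; first exact: ltW.
rewrite subr_ge0 exprn_ile1//; first by rewrite ltW ?fbody_gt0.
by rewrite gerBl divr_ge0 ?(ltW cp)// ltW.
Qed.

Let Rev_F_ge0 r : 0 <= r -> (0 <= Rev m.+2 F r)%E.
Proof.
move=> r0; rewrite RevE// adde_ge0//.
  by rewrite lee_fin mulr_ge0// subr_ge0 exprn_ile1// ?cdfr_ge0 ?cdfr_le1.
by apply: integral_ge0 => t _; rewrite lee_fin mulr_ge0// G_ge0// cdfr01.
Qed.

Lemma RevQ_F_le Q' : supported b Q' -> (RevQ m.+2 F Q' <= value%:E)%E.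
Proof.
(* Cutting to [0, b] changes the revenue on a null set of [Q'] only and makes the bounds hold at
   every reserve. *)
move=> sQ'; pose h := Rev m.+2 F \_ `[0, b].
have mh : measurable_fun setT h.
  have [hh _] := measurable_restrictT (Rev m.+2 F) (measurable_itv `[0, b]).
  by apply: hh; apply: measurable_funTS; exact: measurable_Rev.
have -> : RevQ m.+2 F Q' = (\int[Q']_r h r)%E.
  apply: ae_eq_integral => //; first exact: measurable_Rev.
  exists (~` `[0, b]%classic); split.
  - by apply: measurableC; exact: measurable_itv.
  - exact: supported_setC.
  - by apply: subsetC => r rb _; rewrite /h patchE mem_set.
apply: (@le_trans _ _ (\int[Q']_r (cst value%:E r))%E); last first.
  rewrite integral_cst// [X in (_ * X)%E](_ : _ = 1%E) ?mule1//.
  exact: probability_setT.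
apply: ge0_le_integral => //.
- move=> r _; rewrite /h patchE; case: ifPn => //; rewrite inE/= in_itv/=.
  by move=> /andP[r0 _]; exact: Rev_F_ge0.
- move=> r _; rewrite /h patchE; case: ifPn => [|_].
    by rewrite inE/= in_itv/= => /andP[r0 rb]; exact: Rev_F_le.
  rewrite /= lee_fin; apply: le_trans peak_le; apply: mulr_ge0; first exact: ltW.
  rewrite subr_ge0 exprn_ile1//; first by rewrite ltW ?fbody_gt0.
  by rewrite gerBl divr_ge0 ?(ltW cp)// ltW.
Qed.

(** Up to null sets [Q] charges only 0 and ]w, b[. At 0 the revenue is [value]; a reserve in ]w, b[
    entails w < b, and then [v0E] and [indifference] make [peak] equal to [value]. *)
Lemma RevQ_FQ : RevQ m.+2 F Q = value%:E.
Proof.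
transitivity (\int[Q]_r (cst value%:E r))%E; last first.
  rewrite integral_cst// [X in (_ * X)%E](_ : _ = 1%E) ?mule1//.
  exact: probability_setT.
apply: ae_eq_integral => //; first exact: measurable_Rev.
have n1 : Q.-negligible (~` `[0, b]%classic).
  apply/negligibleP; first by apply: measurableC; exact: measurable_itv.
  exact: (supported_setC supported_Q).
have n2 : Q.-negligible `]0, w]%classic.
  apply/negligibleP; first exact: measurable_itv.
  have -> : `]0, w]%classic = `]-oo, w] `\` `]-oo, 0].
    apply/seteqP; split => y /=; rewrite !in_itv/=.
      by move=> /andP[y0 yw]; split => //; apply/negP; rewrite -ltNge.
    by move=> [yw /negP]; rewrite -ltNge => ->.
  rewrite measureD//=; last by rewrite -ge0_fin_numE// fin_num_measure.
  rewrite setIidr; last first.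
    by move=> y /=; rewrite !in_itv/= => /le_trans; apply; exact: ltW.
  rewrite -!cdfrK !cdfrQ !Qcdf_low ?(ltW w0)//; exact: subee.
have n3 : Q.-negligible `[b, +oo[%classic.
  apply/negligibleP; first exact: measurable_itv.
  have : Q (~` `]-oo, b[%classic) = 0%E.
    by rewrite probability_setC// Q_left// cdfrQ Qcdf_ge// subee.
  by rewrite setCitvl.
apply: negligibleS (negligibleU (negligibleU n1 n2) n3) => r /= hr.
have [/andP[r0 rb]|nb] := boolP (0 <= r <= b); last first.
  by left; left; apply/negP; rewrite in_itv.
have [br|rb'] := leP b r; first by right; rewrite in_itv/= br.
have [rw|wr] := leP r w; last first.
  exfalso; apply: hr => _; rewrite Rev_F_mid ?ltW// /cst; congr EFin.
  rewrite /value (v0E (lt_trans wr rb')) mulr1 indifference.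
  by rewrite subrKC.
move: r0; rewrite le_eqVlt => /predU1P[r0|r0]; last by left; right; rewrite in_itv/= r0.
by exfalso; apply: hr => _; rewrite -r0 Rev_F_0.
Qed.

(* The multiplier of the constraint that [F'] has mean [mu]. *)
Let lam : R := m.+2%:R * qcoef m w b.

(** From [w] on this is [lagrangian_min] with a = F(x) and y = [qlog x]. Below [w] the function of f
    is the one at [w], since the slope vanishes there and [Q] is flat; it is minimal at [hold] and,
    with the same value, at 0, which settles the levels below [v0]. *)
Let pointwise_min x f : 0 <= x -> x < b -> 0 <= f ->
  lagrangian m.+2 (slope x) (cdfr Q x) lam (cdfr F x) <=
  lagrangian m.+2 (slope x) (cdfr Q x) lam f.
Proof.
move=> x0 xb f0; rewrite cdfrQ cdfrF.
have main z : w <= z ->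
    let K := qcoef m w b * qratio m w z ^+ m.+1 in let a := 1 - c / z in
    let s := K * (1 - M * ((1 - a) / a) * qlog m w z) in
    s = qslope m w b z /\
    lagrangian m.+2 s (qbody m w b z) lam a <= lagrangian m.+2 s (qbody m w b z) lam f.
  move=> wz K a s; have cz := lt_le_trans cw wz.
  have a0 : 0 < a by exact: fbody_gt0.
  have ua : qratio m w z = a^-1 by exact: qratioE.
  have K0 : 0 <= K.
    by rewrite mulr_ge0 ?(ltW (qcoef_gt0 _ _ _))// exprn_ge0// ltW// qratio_gt0.
  split; first by rewrite /qslope -/K ua; congr (_ * (1 - _ * _ * _)); field; rewrite gt_eqF.
  have -> : lam = m.+2%:R * (K * a ^+ m.+1).
    by rewrite /lam /K ua exprVn mulfVK// expf_neq0// gt_eqF.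
  exact: (lagrangian_min K0 a0 f0 (qlog_lower m0 w0 wz)).
have [wx|xw] := leP w x.
  have [sE L] := main x wx.
  by rewrite Qcdf_mid ?(ltW xb)// Fcdf_mid// slope_mid ?wx// -sE.
have [sE L] := main w (lexx w).
rewrite slope_low// Qcdf_low ?(ltW xw)//.
have h0 : 0 < hold by exact: fbody_gt0.
have s0 : qslope m w b w = 0.
  rewrite /qslope (qratioE w0 cw) -/hold /qlog divff ?gt_eqF// ln1 addr0 /qmin.
  rewrite (_ : M - M^-1 = M * hold); last by rewrite holdE; field; rewrite gt_eqF.
  rewrite (_ : 1 - _ = 1 - M ^+ 2 * (1 - hold)); last by field; rewrite gt_eqF.
  by rewrite holdE subKr divff ?subrr ?mulr0// expf_neq0// gt_eqF.
move: L; rewrite sE s0 -/hold => L.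
have [xv|vx] := ltP x v0; last by rewrite Fcdf_low.
rewrite Fcdf_neg//; apply: le_trans L; rewrite /lagrangian !mul0r !add0r mulr0 addr0.
rewrite /qbody /lam (qratioE w0 cw) -/hold /qlog divff ?gt_eqF// ln1 addr0 /qmin.
rewrite (_ : M - M^-1 = M * hold); last by rewrite holdE; field; rewrite gt_eqF.
rewrite /second_tail !expr0n /= mulr0 subr0 mulr0 addr0 mulr1 (exprS hold m.+1).
have vp : (hold^-1) ^+ m.+1 * hold ^+ m.+1 = 1.
  by rewrite exprVn mulVf// expf_neq0// gt_eqF.
have hM : M ^+ 2 * hold = M ^+ 2 - 1.
  by rewrite holdE mulrBr mulr1 divff// expf_neq0// gt_eqF.
(* The tie between 0 and [hold], where the value 1 - 1/M^2 is decisive. *)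
rewrite le_eqVlt; apply/orP; left; apply/eqP.
move: (hold^-1 ^+ m.+1) (hold ^+ m.+1) vp => v p vp; rewrite -(natr1 m.+1).
rewrite (_ : _ + _ * hold = qcoef m w b * v * (M * hold)
  + qcoef m w b * hold * ((v * p) * (M ^+ 2 * hold - M * (M + 1)) + (M + 1))); last by ring.
by rewrite vp hM; ring.
Qed.

Lemma RevQ_Q_le F' : supported b F' -> 'E_F'[idTR]%E = 'E_F[idTR]%E ->
  (RevQ m.+2 F Q <= RevQ m.+2 F' Q)%E.
Proof.
move=> sF' EF'.
have lam0 : 0 <= lam by rewrite mulr_ge0// ltW// qcoef_gt0.
pose A (H : law R) t := slope t * (1 - cdfr H t ^+ m.+2) + cdfr Q t * G (cdfr H t).
have A0 H t : 0 <= A H t.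
  rewrite addr_ge0 ?mulr_ge0 ?slope_ge0 ?cdfr_ge0 ?G_ge0 ?cdfr01//.
  by rewrite subr_ge0 exprn_ile1 ?cdfr_ge0 ?cdfr_le1.
have mX H k : measurable_fun setT (fun t => cdfr H t ^+ k).
  by apply: measurable_funX; exact: measurable_cdfr.
have mA H : measurable_fun setT (A H).
  apply: measurable_funD; apply: measurable_funM.
  - exact: measurable_slope.
  - exact: measurable_funB.
  - exact: measurable_cdfr.
  - by apply: measurable_funD; [apply: measurable_funB => //|];
      apply: measurable_funM => //; exact: mX.
have mB H : measurable_fun setT (fun t => lam * (1 - cdfr H t)).
  by apply: measurable_funM => //; apply: measurable_funB => //; exact: measurable_cdfr.
have B0 H t : 0 <= lam * (1 - cdfr H t) by rewrite mulr_ge0// subr_ge0 cdfr_le1.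
have intB H : supported b H ->
    (\int[leb]_(t in `[0%R, b[) (lam * (1 - cdfr H t))%:E = lam%:E * 'E_H[idTR])%E.
  move=> sH; rewrite (mean_cdfr (ltW bp) sH) -ge0_integralZl//.
  - apply/measurable_EFinP/measurable_funB => //; exact: measurable_cdfr.
  - by move=> t _; rewrite lee_fin subr_ge0 cdfr_le1.
have split H H' : (\int[leb]_(t in `[0%R, b[) (A H t + lam * (1 - cdfr H' t))%:E =
    \int[leb]_(t in `[0%R, b[) (A H t)%:E +
    \int[leb]_(t in `[0%R, b[) (lam * (1 - cdfr H' t))%:E)%E.
  under eq_integral do rewrite EFinD.
  rewrite ge0_integralD//.
  - by move=> t _; rewrite lee_fin.
  - by apply/measurable_EFinP; apply: measurable_funTS; exact: mA.
  - by move=> t _; rewrite lee_fin.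
  - by apply/measurable_EFinP; apply: measurable_funTS; exact: mB.
rewrite !RevQ_QE//; last exact: supported_F.
(* The means being equal, each side receives the mean term of the other law. The Lagrangian
   inequality then compares nonnegative integrands, with no subtraction in the extended reals. *)
rewrite -(@leeD2rE _ (lam%:E * 'E_F[idTR])%E); last by rewrite mean_F.
rewrite -{1}EF' -(intB F' sF') -(intB F supported_F) -!split.
apply: ge0_le_integral => //.
- by move=> t _; rewrite lee_fin addr_ge0.
- apply/measurable_EFinP; apply: measurable_funTS.
  by apply: measurable_funD; [exact: mA|exact: mB].
- apply/measurable_EFinP; apply: measurable_funTS.
  by apply: measurable_funD; [exact: mA|exact: mB].
- move=> t /=; rewrite in_itv/= => /andP[t0 tb]; rewrite lee_fin.
  have := pointwise_min t0 tb (cdfr_ge0 F' t).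
  by rewrite /lagrangian -/(A F t) -/(A F' t); lra.
Qed.

Lemma equilibrium_laws mu : v0 + c / w * (w - v0) + c * (ln b - ln w) = mu ->
  equilibrium m.+2 mu b Q F.
Proof.
move=> muE; split.
- exact: supported_Q.
- by split; [exact: supported_F|rewrite mean_F muE].
- by move=> Q' sQ'; rewrite RevQ_FQ; exact: RevQ_F_le.
- by move=> F' [sF' EF']; apply: RevQ_Q_le => //; rewrite EF' mean_F muE.
Qed.

End EquilibriumGame.

(** * From equilibrium to maximin and minimax *)

Section SaddlePoint.
Context {R : realType}.
Variables (n : nat) (mu b : R) (Q F : law R).
Hypothesis QF : equilibrium n mu b Q F.
Local Open Scope ereal_scope.

Lemma equilibrium_maximin : maximin n mu b Q.
Proof.
have [cQ cF leQ leF] := QF; split => // Q' cQ'.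
apply: (@le_trans _ _ (RevQ n F Q)).
  by apply: le_trans (leQ Q' cQ'); apply: ereal_inf_lbound; exists F.
by apply: le_ereal_inf_tmp => _ [F' cF' <-]; exact: leF.
Qed.

Lemma equilibrium_minimax : minimax n mu b F.
Proof.
have [cQ cF leQ leF] := QF; split => // F' cF'.
apply: (@le_trans _ _ (RevQ n F Q)).
  by apply: ge_ereal_sup => _ [Q' cQ' <-]; exact: leQ.
by apply: le_trans (leF F' cF') _; apply: ereal_sup_ubound; exists Q.
Qed.

End SaddlePoint.

(** * Agreement with the closed forms *)

Section ClosedForms.
Context {R : realType}.
Variables (m : nat) (w b : R).
Hypotheses (m0 : (0 < m)%N) (w0 : 0 < w) (wb : w <= b).
Local Notation M := (m.+1%:R : R).
Implicit Types v r mu : R.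

Let natrB1 : m.+2%:R - 1 = M. Proof. by rewrite -(natr1 m.+1) addrK. Qed.
Let Mp : 0 < M. Proof. by rewrite ltr0n. Qed.
Let M1 : 1 < M. Proof. by rewrite ltr1n. Qed.
Let M0 : M != 0. Proof. by rewrite gt_eqF. Qed.
Let M0' : 1 + m%:R != 0 :> R. Proof. by rewrite addrC natr1. Qed.
Let bp : 0 < b. Proof. exact: lt_le_trans w0 wb. Qed.

Lemma Fcdf_lowE v : Fcdf m w b (w / M) v = Fstar_low m.+2 b w v.
Proof.
have wM : w / M < w by rewrite ltr_pdivrMr// ltr_pMr.
rewrite /Fstar_low /v0_low natrB1; case: ltP => vv; first exact: Fcdf_neg.
case: ltP => vw.
  by rewrite Fcdf_low// /fscale mulrAC divff ?mul1r// gt_eqF.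
have v0 : v != 0 by rewrite gt_eqF// (lt_le_trans w0).
case: ltP => vb; last exact: Fcdf_ge.
by rewrite Fcdf_mid// /fscale; field; rewrite M0' v0.
Qed.

Lemma Fcdf_highE mu v : w = b -> Fcdf m w b (v0_high m.+2 mu b) v = Fstar_high m.+2 mu b v.
Proof.
move=> ->; rewrite /Fstar_high /Fcdf natrB1; case: ltP => // vv.
case: ltP => // vb; rewrite ?max_l ?ltW// /fscale mulrAC divff ?mul1r//.
by rewrite gt_eqF.
Qed.

Lemma Qcdf_lowE r : Qcdf m w b r = Qstar_low m.+2 b w r.
Proof.
have cE z : w <= z -> qbody m w b z =
    (1 - v0_low m.+2 w / (b * M)) ^+ m.+1
      * (M * z / (M * z - v0_low m.+2 w)) ^+ m.+1 * (qlog m w z / qlog m w b).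
  move=> wz; have zp := lt_le_trans w0 wz.
  have cz : fscale m w < z by apply: lt_le_trans wz; exact: fscale_lt.
  rewrite /qbody /qcoef /v0_low natrB1.
  have -> : w / M / (b * M) = fscale m w / b.
    by rewrite /fscale; field; rewrite M0' gt_eqF.
  have -> : M * z / (M * z - w / M) = qratio m w z.
    rewrite /qratio (_ : w / M = M * fscale m w); last by rewrite /fscale; field; rewrite M0'.
    by rewrite -mulrBr invfM mulrACA divff// mul1r.
  by rewrite -!mulrA; congr (_ * _); rewrite mulrCA; congr (_ * _); exact: mulrC.
rewrite /Qstar_low natrB1 subn1 /=; case: ltP => r0; first by rewrite /Qcdf r0.
case: ltP => rw.
  rewrite Qcdf_low ?(ltW rw)// cE// /qlog divff ?gt_eqF// ln1 addr0.
  congr (_ * _ ^+ _ * _).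
    rewrite /v0_low natrB1 (_ : M * w - w / M = (M ^+ 2 - 1) * (w / M)); last first.
      by field; rewrite M0'.
    rewrite (_ : M * w = M ^+ 2 * (w / M)); last by field; rewrite M0'.
    by rewrite invfM mulrACA divff ?mulr1// gt_eqF// divr_gt0.
case: leP => rb; last by rewrite Qcdf_ge// ltW.
by rewrite Qcdf_mid// cE.
Qed.

Lemma Qcdf_highE r : w = b -> Qcdf m w b r = Qstar_high r.
Proof.
move=> wE; rewrite /Qstar_high; case: ltP => r0; first by rewrite /Qcdf r0.
have [rw|wr] := leP r w; last by apply: Qcdf_ge => //; rewrite -wE ltW.
by rewrite Qcdf_low// wE qbody_b.
Qed.

End ClosedForms.

(** * Assembly of the two cases *)

Theorem theorem4p1 (R : realType) (n : nat) (mu vbar : R) :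
  (3 <= n)%N -> 0 < mu -> mu < vbar ->
  exists vl vh : R,
    [/\ 0 < vl, vl < vh,
        (forall x : R, 0 < x -> (vlow_eq n mu vbar x <-> x = vl \/ x = vh))
      & exists Qs Fs : law R,
          [/\ equilibrium n mu vbar Qs Fs,
              maximin n mu vbar Qs,
              minimax n mu vbar Fs,
              (vl <= vbar ->
                 (forall v : R, cdf_law Fs v = (Fstar_low n vbar vl v)%:E) /\
                 (forall r : R, cdf_law Qs r = (Qstar_low n vbar vl r)%:E))
            & (vbar <= vl ->
                 (forall v : R, cdf_law Fs v = (Fstar_high n mu vbar v)%:E) /\
                 (forall r : R, cdf_law Qs r = (Qstar_high r)%:E))]].
Proof.
case: n => [|[|m]] // n3 mu0 mub.
have m0 : (0 < m)%N by rewrite -(ltn_add2r 2) !addn2.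
have b0 : 0 < vbar := lt_trans mu0 mub.
have [vl [vh [vl0 vlh roots high]]] := vlow_eq_roots m0 mu0 mub.
have nE : m.+2%:R - 1 = m.+1%:R :> R by rewrite -(natr1 m.+1) addrK.
set M : R := m.+1%:R in high nE.
have M1 : 1 < M by rewrite ltr1n.
have Mp : 0 < M by rewrite ltr0n.
have M0 : M != 0 by rewrite gt_eqF.
have M21 : 0 < M ^+ 2 - 1 by rewrite subr_gt0 exprn_egt1.
have M21' : M ^+ 2 - 1 != 0 by rewrite gt_eqF.
have vleq : (M + 1 - M^-1 + ln (vbar / vl)) * vl = M ^+ 2 * mu.
  have [_ /(_ (or_introl erefl))] := roots vl vl0.
  by rewrite /vlow_eq nE (_ : m.+2%:R = M + 1 :> R) //; rewrite /M natr1.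
have highE : v0_high m.+2 mu vbar = mu - (vbar - mu) / (M ^+ 2 - 1).
  by rewrite /v0_high nE.
exists vl, vh; split; [exact: vl0|exact: vlh|exact: roots|].
have [le_vl|lt_vl] := leP vl vbar.
  have v0w : vl / M < vl by rewrite ltr_pdivrMr// ltr_pMr.
  have [Q QE] := Qcdf_law_exists m0 vl0 le_vl.
  have [F FE] := Fcdf_law_exists m0 vl0 le_vl v0w (lexx (vl / M)).
  have eqQF : equilibrium m.+2 mu vbar Q F.
    apply: (equilibrium_laws m0 vl0 le_vl v0w (lexx _) _ QE FE) => //.
    (* The equation for [vl] is exactly the constraint that [F] has mean mu. *)
    rewrite ln_div ?posrE// in vleq; move: vleq; rewrite /fscale -/M.
    move: (ln vbar - ln vl) => l vleq.
    transitivity ((M + 1 - M^-1 + l) * vl / M ^+ 2).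
      by clearbody M; field; rewrite M0 gt_eqF.
    by rewrite vleq mulrC mulKf// expf_neq0.
  exists Q, F; split; first exact: eqQF.
  - exact: equilibrium_maximin eqQF.
  - exact: equilibrium_minimax eqQF.
  - by move=> _; split => x; rewrite ?FE ?QE ?Fcdf_lowE ?Qcdf_lowE.
  (* On the common boundary vl = vbar the root equation makes the two values of v0 coincide, so the
     same pair also has the second form. *)
  - move=> ge_vl; have vlE : vl = vbar by apply/eqP; rewrite eq_le le_vl.
    have v0E : vl / M = v0_high m.+2 mu vbar.
      move: vleq; rewrite highE vlE divff ?gt_eqF// ln1 addr0 => vleq.
      have -> : mu = (M + 1 - M^-1) * vbar / M ^+ 2.
        by rewrite vleq mulrC mulKf// expf_neq0.
      by clearbody M; field; rewrite M0 M21'.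
    by split => x; rewrite ?FE ?QE ?v0E ?Fcdf_highE ?Qcdf_highE.
(* Here w = vbar, so the tail is empty, v0 is the solution of the mean constraint, and [high]
   supplies w / M <= v0. *)
have ge_vl := ltW lt_vl; have {}high := high ge_vl.
have v0w : v0_high m.+2 mu vbar < vbar.
  rewrite highE (lt_trans _ mub)// gtrBl divr_gt0// subr_gt0.
  exact: mub.
have wv0 : vbar / M <= v0_high m.+2 mu vbar.
  rewrite highE -subr_ge0.
  rewrite (_ : _ - _ = (M ^+ 2 * mu - (M - M^-1 + 1) * vbar) / (M ^+ 2 - 1)).
    by apply: divr_ge0; [rewrite subr_ge0|exact: ltW].
  by clearbody M; field; rewrite M0 M21'.
have [Q QE] := Qcdf_law_exists m0 b0 (lexx vbar).
have [F FE] := Fcdf_law_exists m0 b0 (lexx vbar) v0w wv0.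
have eqQF : equilibrium m.+2 mu vbar Q F.
  apply: (equilibrium_laws m0 b0 (lexx vbar) v0w wv0 _ QE FE).
    by rewrite ltxx.
  rewrite subrr mulr0 addr0 /fscale -/M highE.
  by clearbody M; field; rewrite M0 M21' gt_eqF.
exists Q, F; split; first exact: eqQF.
- exact: equilibrium_maximin eqQF.
- exact: equilibrium_minimax eqQF.
- by [].
- by move=> _; split => x; rewrite ?FE ?QE ?Fcdf_highE ?Qcdf_highE.
Qed.
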